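(* Let $K$ be a number field with ring of integers $\mathcal{O}_K$. Fix an integer $N>0$. Suppose $f(x)\in\mathcal{O}_K[x]$ has a leading coefficient that is a unit of $\mathcal{O}_K$, and let $a\in\mathcal{O}_K$ be such that $f^n(x)-a$ is irreducible over $K$ for $1\le n\le N$. Let $\mathfrak{p}$ be a (nonzero) prime ideal of $\mathcal{O}_K$. Then there exist a polynomial $g(x)=g_{\mathfrak{p}}(x)\in\mathcal{O}_K[x]$ and a natural number $N_{\mathfrak{p}}$ such that the following property holds: $(\ast)$ For every finite extension $M$ of $K$ over which $g(x)$ splits and every prime $\mathfrak{P}$ of $M$ above $\mathfrak{p}$: the polynomial $f^n(x)-a$ is $\mathfrak{p}$-maximal for each $1\le n\le N$ if and only if for each root $\theta\in M$ of $g(x)$ and each $1\le n\le N_{\mathfrak{p}}$ one has $v_{\mathfrak{P}}(f^n(\theta)-a)\le e(\mathfrak{P}\mid\mathfrak{p})$. More concretely, $(\ast)$ holds with the following choices: 1. If $\mathfrak{p}$ is non-exceptional for $(f(x),a)$, one may choose $N_{\mathfrak{p}}=N$ and $g(x)=f'(x)$ (independently of $\mathfrak{p}$ and $a$). 2. If $\mathfrak{p}$ is exceptional for $(f(x),a)$ but $f'(x)\not\equiv 0 \bmod \mathfrak{p}$, one may choose $N_{\mathfrak{p}}=N$ and $g(x)=\prod_{i=1}^r\phi_i(x)$ (independently of $a$), where the $\phi_i(x)\in\mathcal{O}_K[x]$ are lifts to $\mathcal{O}_K[x]$ of the distinct irreducible factors of $f'(x)$ in $k_{\mathfrak{p}}[x]$.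 3. If $f'(x)\equiv 0\bmod\mathfrak{p}$, one may choose $N_{\mathfrak{p}}=1$ and any $g(x)\in\mathcal{O}_K[x]$ fulfilling $f(x)-a=g(x)^p$ in $k_{\mathfrak{p}}[x]$, where $p=\operatorname{char}k_{\mathfrak{p}}$.
   Context: $f^n$ denotes the $n$-fold composition of $f$; $\mathbb{N}=\{1,2,\dots\}$. For a prime $\mathfrak{p}$ of $\mathcal{O}_K$, $k_{\mathfrak{p}}=\mathcal{O}_K/\mathfrak{p}$ is the residue field and $\mathcal{O}_{\mathfrak{p}}$ is the localization of $\mathcal{O}_K$ at $\mathfrak{p}$. For a prime $\mathfrak{P}$ of an extension above $\mathfrak{p}$, $v_{\mathfrak{P}}$ is the normalized $\mathfrak{P}$-adic valuation (values in $\mathbb{Z}\cup\{\infty\}$) and $e(\mathfrak{P}\mid\mathfrak{p})$ is the ramification index. $\mathfrak{p}$-maximality: if $\alpha$ is integral and algebraic over $K$ and $L=K(\alpha)$, the ring $\mathcal{O}_K[\alpha]$ is $\mathfrak{p}$-maximal if $\mathcal{O}_K[\alpha]\otimes_{\mathcal{O}_K}\mathcal{O}_{\mathfrak{p}}=\mathcal{O}_L\otimes_{\mathcal{O}_K}\mathcal{O}_{\mathfrak{p}}$. An irreducible polynomial over $\mathcal{O}_K$ with unit leading coefficient is called $\mathfrak{p}$-maximal if $\mathcal{O}_K[\alpha]$ is $\mathfrak{p}$-maximal for a root $\alpha$. Exceptional primes: $\mathfrak{p}$ is non-exceptional for $(f(x),a)$ if $f'(x)\not\equiv 0\bmod\mathfrak{p}$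 and, for every irreducible factor $h(x)$ of $f'(x)$ in $K[x]$, every irreducible factor $\phi(x)$ of $h(x)$ in $k_{\mathfrak{p}}[x]$, and every $n\in\mathbb{N}$ such that $\phi(x)$ divides $f^n(x)-a$ in $k_{\mathfrak{p}}[x]$, the multiplicity of $\phi(x)$ in $f^n(x)-a$ (in $k_{\mathfrak{p}}[x]$) is strictly larger than the multiplicity of $\phi(x)$ in $h(x)$ (in $k_{\mathfrak{p}}[x]$). Here an irreducible factor $h(x)\in K[x]$ is scaled so that its coefficients lie in $\mathcal{O}_{\mathfrak{p}}$ and are not all in the maximal ideal, so that its reduction in $k_{\mathfrak{p}}[x]$ is defined and nonzero. Otherwise $\mathfrak{p}$ is exceptional for $(f(x),a)$. *)

(* Defs.v *)
From HB Require Import structures.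
From mathcomp Require Import all_boot all_order all_algebra all_field.
From mathcomp Require Import ring_quotient.
From mathcomp Require Import boolp classical_sets constructive_ereal.

Set Implicit Arguments.
Unset Strict Implicit.
Unset Printing Implicit Defensive.

Import Order.TTheory GRing.Theory Num.Theory.
Local Open Scope ring_scope.

(* The ring of integers of a field F is the integral closure of Z in F; the   *)
(* membership predicate is made boolean classically.                          *)
Definition integers (F : fieldType) : {pred F} :=
  fun x => `[< integralOver (intr : int -> F) x >].

Arguments integers : clear implicits.

Lemma integersP (F : fieldType) (x : F) :
  reflect (integralOver (intr : int -> F) x) (x \in integers F).
Proof. exact: asboolP. Qed.

Lemma integers_subring (F : fieldType) : subring_closed (integers F).
Proof.
split.
- by apply/integersP; apply: integral1.
- by move=> x y /integersP ? /integersP ?; apply/integersP/integral_sub.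
- by move=> x y /integersP ? /integersP ?; apply/integersP/integral_mul.
Qed.

HB.instance Definition _ (F : fieldType) :=
  GRing.isSubringClosed.Build F (integers F) (@integers_subring F).

Record ringInt (F : fieldType) :=
  RingInt { ringInt_val :> F; _ : ringInt_val \in integers F }.
Arguments ringInt_val {F} _.

Section RingIntTheory.
Variable F : fieldType.

HB.instance Definition _ := [isSub for @ringInt_val F].
HB.instance Definition _ := [Choice of ringInt F by <:].
HB.instance Definition _ := [SubChoice_isSubComNzRing of ringInt F by <:].

Definition ringInt_unit : pred (ringInt F) :=
  fun x => (x != 0) && ((val x)^-1 \in integers F).
Definition ringInt_inv (x : ringInt F) : ringInt F := insubd x (val x)^-1.

Lemma ringInt_mulV : {in ringInt_unit, left_inverse 1 ringInt_inv *%R}.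
Proof.
move=> x /andP[x0 xV]; apply: val_inj.
by rewrite rmorphM rmorph1 /= insubdK // mulVf // (inj_eq val_inj x 0).
Qed.

Lemma ringInt_unitP (x y : ringInt F) : y * x = 1 -> ringInt_unit x.
Proof.
move=> yx; have x0 : x != 0.
  by apply: contra_eq_neq yx => ->; rewrite mulr0 eq_sym oner_eq0.
rewrite /ringInt_unit x0 /=.
have vx0 : val x != 0 by rewrite (inj_eq val_inj x 0).
suff <- : val y = (val x)^-1 by exact: valP.
apply: (mulIf vx0); rewrite mulVf // -rmorphM yx.
by rewrite rmorph1.
Qed.

Lemma ringInt_invr_out : {in [predC ringInt_unit], ringInt_inv =1 id}.
Proof.
move=> x; rewrite inE /= negb_and negbK => /orP[/eqP->|xV]; apply: val_inj.
  by rewrite val_insubd rmorph0 invr0 if_same.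
by rewrite val_insubd (negbTE xV).
Qed.

HB.instance Definition _ := GRing.ComNzRing_hasMulInverse.Build (ringInt F)
  ringInt_mulV ringInt_unitP ringInt_invr_out.
HB.instance Definition _ :=
  [SubComUnitRing_isSubIntegralDomain of ringInt F by <:].

End RingIntTheory.

Notation "''O_' F" := (ringInt F) (at level 8, F at level 2, format "''O_' F")
  : type_scope.

Record nzPrime (F : fieldType) := NzPrime {
  nzPrime_ideal :> prime_idealr 'O_F;
  nzPrime_neq0 : exists x : 'O_F, x != 0 /\ x \in nzPrime_ideal
}.

Section ResidueField.

Definition no_zero_div (R : nzRingType) :=
  forall x y : R, x * y = 0 -> (x == 0) || (y == 0).

Lemma integral_multiple (R : comNzRingType) (x : R) :
  no_zero_div R -> x != 0 -> integralOver (intr : int -> R) x ->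
  exists (c : int) (t : R), c%:~R != 0 :> R /\ c%:~R = t * x.
Proof.
move=> domR x0 [q mq qx]; have [n] := ubnP (size q).
elim: n q mq qx => // n IH q mq qx sq.
have eq_q : q = drop_poly 1 q * 'X + (q`_0)%:P.
  rewrite -[LHS](poly_take_drop 1) addrC expr1; congr (_ + _).
  apply/polyP=> i; rewrite coef_take_poly coefC.
  by case: i.
have ex : ((map_poly intr (drop_poly 1 q)).[x] : R) * x + (q`_0)%:~R = 0.
  move/eqP: qx; rewrite {1}eq_q rmorphD rmorphM /= map_polyX map_polyC /=.
  by rewrite hornerD hornerM hornerX hornerC.
have [c0|c0] := eqVneq ((q`_0)%:~R : R) 0; last first.
  exists q`_0, (- (map_poly intr (drop_poly 1 q)).[x]); split; first exact: c0.
  by rewrite mulNr; apply/eqP; rewrite -subr_eq0 opprK addrC ex.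
move: ex; rewrite c0 addr0 => /domR; rewrite (negbTE x0) orbF => rx.
have sq1 : (1 < size q)%N.
  rewrite ltnNge; apply/negP => /size1_polyC qE.
  move: mq c0; rewrite qE monicE lead_coefC coefC /= => /eqP ->.
  by move/eqP; rewrite oner_eq0.
apply: (IH (drop_poly 1 q)) => //.
  rewrite monicE lead_coefE coef_drop_poly size_drop_poly.
  by move: mq; rewrite monicE lead_coefE subn1 addn1 prednK // -subn1 subn_gt0.
by rewrite size_drop_poly; move: sq sq1; case: (size q) => [|m] //; rewrite subn1.
Qed.

Lemma domain_int_inv (R : comNzRingType) (n : nat) (c : int) :
  no_zero_div R -> (0 < n)%N -> n%:R == 0 :> R -> c%:~R != 0 :> R ->
  exists t : R, t * c%:~R = 1.
Proof.
move=> domR n0 nR c0.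
have ex : exists m, (0 < m)%N && (m%:R == 0 :> R) by exists n; rewrite n0.
case: (ex_minnP ex) => m /andP[m0 mR] minm.
have [u [v uv]] := Bezoutz c m; exists u%:~R.
have mz : (m%:Z)%:~R = 0 :> R by exact/eqP.
have ecm : gcdz c m = gcdn `|c| m by [].
have /dvdnP[k km] := dvdn_gcdr `|c|%N m.
have : (k%:R * (gcdn `|c| m)%:R : R) = 0 by rewrite -natrM -km (eqP mR).
have k0 : (0 < k)%N by move: m0; rewrite km; case: (k).
have g0 : (0 < gcdn `|c| m)%N by rewrite gcdn_gt0 m0 orbT.
case/domR/orP => [kR|gR].
  have := minm k; rewrite k0 kR => /(_ isT); rewrite {1}km.
  rewrite -[X in (_ <= X)%N]muln1 leq_pmul2l // => g1.
  have {g0 g1} g1 : gcdn `|c| m = 1%N by apply/eqP; rewrite eqn_leq g1.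
  have e1 : (gcdz c m)%:~R = 1 :> R by rewrite ecm g1.
  by rewrite -[RHS]e1 -uv rmorphD /= (rmorphM _ v) /= mz mulr0 addr0 rmorphM.
have gm : gcdn `|c| m = m.
  apply/eqP; rewrite eqn_leq dvdn_leq ?dvdn_gcdr //=.
  by apply: minm; rewrite g0.
case/negP: c0; have /dvdnP[d dE] : (m %| `|c|)%N by rewrite -gm dvdn_gcdl.
rewrite [c]intEsign dE rmorphM /= PoszM rmorphM /= mz.
by rewrite !mulr0.
Qed.

Variables (F : fieldType) (P : nzPrime F).

(* O_F / P; it is a field because P is a nonzero prime. *)
Definition residue := {ideal_quot (P : prime_idealr 'O_F)}.

HB.instance Definition _ := GRing.ComNzRing.on residue.

Definition reduce : 'O_F -> residue := \pi_residue%qT.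

Fact reduce_zmod : zmod_morphism reduce.
Proof. exact: (@pi_is_zmod_morphism _ _ _ {ideal_quot (P : prime_idealr 'O_F)}). Qed.
Fact reduce_monoid : monoid_morphism reduce.
Proof. exact: pi_is_monoid_morphism. Qed.
HB.instance Definition _ := GRing.isZmodMorphism.Build _ _ reduce reduce_zmod.
HB.instance Definition _ := GRing.isMonoidMorphism.Build _ _ reduce reduce_monoid.

Lemma reduce_eq0 x : (reduce x == 0) = (x \in (P : prime_idealr 'O_F)).
Proof.
by rewrite -(rmorph0 reduce) -Quotient.idealrBE subr0.
Qed.

Lemma reduce_surj (y : residue) : exists x, reduce x = y.
Proof. by exists (repr y); rewrite /reduce reprK. Qed.

Lemma ringInt_integral (x : 'O_F) : integralOver (intr : int -> 'O_F) x.
Proof.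
have /integersP[q mq qx] := valP x; exists q => //.
rewrite rootE -(inj_eq val_inj) rmorph0 -horner_map -map_poly_comp /=.
have e : val \o (intr : int -> 'O_F) =1 (intr : int -> F).
  by move=> z /=; exact: (rmorph_int (val : 'O_F -> F)).
by rewrite (eq_map_poly e).
Qed.

Lemma residue_dom : no_zero_div residue.
Proof. exact: Quotient.rquot_IdomainAxiom. Qed.

Lemma residue_inv_ex (y : residue) : y != 0 -> exists z, z * y = 1.
Proof.
move=> y0.
have [x [x0 xP]] := nzPrime_neq0 P.
have domO : no_zero_div 'O_F by move=> a b /eqP; rewrite mulf_eq0.
have [n [t [n0 nE]]] := integral_multiple domO x0 (ringInt_integral x).
have nR : (n%:~R : residue) == 0.
  by rewrite -(rmorph_int reduce) reduce_eq0 nE idealMr.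
have nR' : (`|n|%N)%:R == 0 :> residue.
  by case: n nR {n0 nE} => m //=; rewrite NegzE mulrNz oppr_eq0.
have n1 : (0 < `|n|)%N.
  by rewrite absz_gt0; apply: contraNneq n0 => ->; rewrite mulr0z.
have [w wE] := reduce_surj y.
have yI : integralOver (intr : int -> residue) y.
  have [q mq qw] := ringInt_integral w; exists q => //.
  have e : reduce \o (intr : int -> 'O_F) =1 (intr : int -> residue).
    by move=> z; exact: (rmorph_int reduce).
  by rewrite -wE rootE -(eq_map_poly e) map_poly_comp horner_map (rootP qw) rmorph0.
have [c [s [c0 cE]]] := integral_multiple residue_dom y0 yI.
have [z zE] := domain_int_inv residue_dom n1 nR' c0.
by exists (z * s); rewrite -mulrA -cE.
Qed.

Definition residue_inv (y : residue) : residue :=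
  xget 0 [set z | z * y = 1].

Lemma residue_mulVf (y : residue) : y != 0 -> residue_inv y * y = 1.
Proof. by move=> /residue_inv_ex; apply: xgetPex. Qed.

Lemma residue_invr0 : residue_inv 0 = 0.
Proof.
apply: xgetPN => z /=; rewrite mulr0 => /esym/eqP.
by rewrite oner_eq0.
Qed.

HB.instance Definition _ :=
  GRing.ComNzRing_isField.Build residue residue_mulVf residue_invr0.

End ResidueField.

Section Localization.
Variables (F : fieldType) (P : nzPrime F).

Definition local_ring : {pred F} := fun x =>
  `[< exists a s : 'O_F, s \notin (P : prime_idealr 'O_F) /\ x = val a / val s >].

Definition local_max_ideal : {pred F} := fun x =>
  `[< exists a s : 'O_F, [/\ a \in (P : prime_idealr 'O_F),
        s \notin (P : prime_idealr 'O_F) & x = val a / val s] >].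

(* The reduction map from the localization of O_F at P onto O_F / P; the      *)
(* value at a / s does not depend on the chosen fraction (local_reduceE), and *)
(* is 0 outside of local_ring.                                                *)
Definition local_reduce (x : F) : residue P :=
  xget 0 [set y | exists a s : 'O_F, [/\ s \notin (P : prime_idealr 'O_F),
                    x = val a / val s & y = reduce P a / reduce P s]].

Lemma local_reduceE (a s : 'O_F) : s \notin (P : prime_idealr 'O_F) ->
  local_reduce (val a / val s) = reduce P a / reduce P s.
Proof.
have nz t : t \notin (P : prime_idealr 'O_F) -> val t != 0.
  apply: contraNneq => t0; suff -> : t = 0 by exact: idealr0.
  by apply: val_inj; rewrite t0 rmorph0.
move=> sP; apply: xget_unique; first by exists a, s.
move=> y [b [t [tP /eqP]]]; rewrite eqr_div ?nz // -!rmorphM => /eqP/val_inj e ->.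
apply/eqP; rewrite eqr_div ?reduce_eq0 // -!rmorphM.
by rewrite e.
Qed.

End Localization.

Definition fiter (R : comNzRingType) (f : {poly R}) (n : nat) : {poly R} :=
  iter n (fun q => f \Po q) 'X.

(* Largest m such that phi ^+ m divides q; meaningful for q != 0 and          *)
(* nonconstant phi.                                                           *)
Definition multiplicity (k : fieldType) (phi q : {poly k}) : nat :=
  \max_(m < size q | phi ^+ m %| q) m.

Section Exceptional.
Variables (F : fieldType) (P : nzPrime F).

Definition reduce_poly : {poly 'O_F} -> {poly residue P} := map_poly (reduce P).

Definition non_exceptional (f : {poly 'O_F}) (a : 'O_F) : Prop :=
  reduce_poly f^`() != 0 /\
  forall h : {poly F},
    irreducible_poly h -> h %| map_poly val f^`() ->
    (forall i, h`_i \in local_ring P) ->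
    (exists i, h`_i \notin local_max_ideal P) ->
  forall (phi : {poly residue P}) (n : nat),
    irreducible_poly phi -> phi %| map_poly (local_reduce P) h -> (0 < n)%N ->
    phi %| reduce_poly (fiter f n - a%:P) ->
    (multiplicity phi (map_poly (local_reduce P) h) <
       multiplicity phi (reduce_poly (fiter f n - a%:P)))%N.

(* phi lists lifts of the irreducible factors of q over O_F / P, each one     *)
(* occurring exactly once up to a nonzero scalar.                             *)
Definition factor_lifts (q : {poly 'O_F}) (r : nat)
    (phi : 'I_r -> {poly 'O_F}) : Prop :=
  [/\ forall i, irreducible_poly (reduce_poly (phi i)) /\
                reduce_poly (phi i) %| reduce_poly q,
      forall i j, reduce_poly (phi i) %= reduce_poly (phi j) -> i = j
    & forall psi : {poly residue P}, irreducible_poly psi ->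
        psi %| reduce_poly q -> exists i, psi %= reduce_poly (phi i)].

End Exceptional.

Section Extension.
Variables (K : fieldExtType rat) (L : fieldExtType K).

Definition ext_poly (q : {poly 'O_K}) : {poly L} :=
  map_poly (fun x : 'O_K => (val x)%:A) q.

Lemma integers_ext (x : 'O_K) : (val x)%:A \in integers L.
Proof.
have /integersP x_int := valP x; apply/integersP.
have := integral_rmorph (in_alg L) x_int.
by case=> q mq qx; exists q => //; rewrite -(eq_map_poly (rmorph_int (in_alg L))).
Qed.

Definition ringInt_ext (x : 'O_K) : 'O_L := RingInt (integers_ext x).

Definition adjoin_integers (alpha : L) : set L :=
  [set x | exists q : {poly 'O_K}, x = (ext_poly q).[alpha]].

(* The localization at p of an O_K-submodule B of L, i.e. the image in L of   *)
(* the tensor product of B with the localization of O_K at p (the map to L    *)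
(* is injective by flatness).                                                 *)
Definition localize (p : nzPrime K) (B : set L) : set L :=
  [set x | exists (n : nat) (c : 'I_n -> K) (b : 'I_n -> L),
     [/\ forall i, c i \in local_ring p, forall i, B (b i)
       & x = \sum_(i < n) c i *: b i]].

Definition maximal_at (p : nzPrime K) (alpha : L) : Prop :=
  localize p (adjoin_integers alpha) = localize p [set x | x \in integers L].

End Extension.

(* Intended for q irreducible over K with unit leading coefficient; the       *)
(* property does not depend on the root, as K(alpha) is unique up to          *)
(* isomorphism.                                                               *)
Definition maximal_poly_at (K : fieldExtType rat) (p : nzPrime K)
    (q : {poly 'O_K}) : Prop :=
  exists (L : fieldExtType K) (alpha : L),
    [/\ root (ext_poly L q) alpha, <<1; alpha>>%VS = fullv :> {vspace L}
      & maximal_at p alpha].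

(* The largest element of Q, 0 by default.                                    *)
Definition largest (Q : set nat) : nat :=
  xget 0%N [set k | Q k /\ forall j, Q j -> (j <= k)%N].

Fixpoint idealX (R : nzRingType) (I : {pred R}) (n : nat) : set R :=
  if n is m.+1 then
    [set x | exists (r : nat) (a b : 'I_r -> R),
       [/\ forall i, a i \in I, forall i, idealX I m (b i)
         & x = \sum_(i < r) a i * b i]]
  else setT.

Section Valuation.
Variables (F : fieldType) (P : nzPrime F).

Definition ringInt_val_at (x : 'O_F) : nat :=
  largest [set k | idealX (P : prime_idealr 'O_F) k x].

(* Normalized P-adic valuation; every nonzero x in a number field F is a      *)
(* quotient of nonzero integers, and all such quotients give the same value.  *)
Definition valuation (x : F) : \bar int :=
  if x == 0 then +oo%E else
  (xget 0 [set z : int | exists a b : 'O_F, [/\ b != 0, x = val a / val b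
     & z = (ringInt_val_at a)%:Z - (ringInt_val_at b)%:Z]])%:E.

End Valuation.

Section Ramification.
Variables (K : fieldExtType rat) (M : fieldExtType K).
Variables (p : nzPrime K) (P : nzPrime M).

Definition lies_above : Prop :=
  forall x : 'O_K, (ringInt_ext M x \in (P : prime_idealr 'O_M)) =
                   (x \in (p : prime_idealr 'O_K)).

(* The exponent of P in the factorization of p O_M, i.e. the largest k such   *)
(* that P ^ k contains p O_M.                                                 *)
Definition ramification_index : nat :=
  largest [set k | forall x : 'O_K, x \in (p : prime_idealr 'O_K) ->
                     idealX (P : prime_idealr 'O_M) k (ringInt_ext M x)].

End Ramification.

(* The zero polynomial splits.                                                *)
Definition splits (M : fieldType) (q : {poly M}) : Prop :=
  exists (c : M) (rs : seq M), q = c *: \prod_(t <- rs) ('X - t%:P).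

Definition maximality_criterion (K : fieldExtType rat) (f : {poly 'O_K})
    (a : 'O_K) (N : nat) (p : nzPrime K) (g : {poly 'O_K}) (Np : nat) : Prop :=
  forall (M : fieldExtType K) (P : nzPrime M),
    splits (ext_poly M g) -> lies_above p P ->
    (forall n, (1 <= n <= N)%N -> maximal_poly_at p (fiter f n - a%:P)) <->
    (forall theta : M, root (ext_poly M g) theta ->
       forall n, (1 <= n <= Np)%N ->
         (valuation P (ext_poly M (fiter f n - a%:P)).[theta]
            <= ((ramification_index p P)%:Z)%:E)%E).

(* Main.v *)
Require Import Defs.
From HB Require Import structures.
From mathcomp Require Import all_boot all_order all_algebra all_field.
From mathcomp Require Import ring_quotient boolp classical_sets constructive_ereal.
From mathcomp Require Import ring zify.
Set Implicit Arguments.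
Unset Strict Implicit.
Unset Printing Implicit Defensive.
Import Order.TTheory GRing.Theory Num.Theory.
Local Open Scope ring_scope.

(** Let [A] be the localization of the ring of integers of [K] at [p], a
    discrete valuation ring with uniformizer [pi] and residue field [k], and let
    [F n] be [f^n - a] as a polynomial over [A].  Dedekind's criterion says that
    [F n] is maximal at [p] if and only if [A[x]/(F n)] is regular, which means
    that [F n] lies in the square of no maximal ideal [(pi, psi)] of [A[x]],
    for [psi] irreducible over [k] ([singular_at], [maximal_poly_at_regular]).
    If [F n = u v + pi w] where [psi] divides [u] and [v] modulo [pi], then
    [F n] is singular at [psi] exactly when [psi] divides [w] modulo [pi]
    ([singular_atE]).

    This can be read off from one value.  Let [theta], in the local ring of [M]
    at [P], reduce to a root of [psi], and suppose that [u(theta) v(theta)] has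
    valuation greater than [e].  Then [F n (theta)] has valuation greater than
    [e] exactly when [w(theta)] is not a unit, that is, when [F n] is singular
    at [psi] ([singular_at_evalE]).  In the three cases such a decomposition is
    provided by the fact that [theta] is a root of [g].  If [g] is a product of
    lifts, [theta] is a root of a lift [phi] of an associate of [psi] and one
    takes [u = phi], as [psi^2] divides [F n] modulo [p].  If [f - a] is [g^l] modulo
    [p], one takes [u = g].  If [g] is the derivative of [f] and [p] is not
    exceptional, [theta] is a root of an irreducible factor [h] of multiplicity
    [m] at [psi]; then [h(theta) = 0] forces [psi(theta)^m] to be divisible by
    [pi], and [psi^(m+1)] divides [F n] modulo [p] by hypothesis.  A
    non-integral [theta] satisfies the inequality for trivial reasons, since
    [F n] has a unit leading coefficient ([eval_notin_local]); and every prime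
    factor of [g] modulo [p] is reached by an integral root, because [g] splits
    over [M] ([splits_root_lift]).

    It remains to see that the prime factors of [g] modulo [p] detect all
    singular points.  A singular point [psi] of [F n] is a repeated factor modulo
    [p], so by the chain rule [f^j] maps it to a critical point of [f] for some
    [j < n].  As [F n] is [F (n - j)] composed with [f^j], that critical point
    is a singular point of [F (n - j)] ([singular_at_comp], [detect_critical]).
    If the derivative of [f] vanishes modulo [p], the same argument with [j = n - 1]
    and [F 1], an [l]-th power modulo [p], leads back to the zeros of [g].

    That the local rings of number fields are discrete valuation rings is proved
    directly.  They are valuation rings because of integrality
    ([local_or_inv_poly]), and discrete because a strictly descending chain of
    divisors of the residue characteristic is linearly independent over the
    rationals ([divisor_chain_bound]). *)

(** * Irreducible polynomials over a field *)

Section IrreducibleFactors.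
Variable k : fieldType.
Implicit Types p q c h phi psi : {poly k}.

Lemma irreducible_dvdM psi p q : irreducible_poly psi ->
  (psi %| p * q) = (psi %| p) || (psi %| q).
Proof.
move=> irr; have [dvd_p|ndvd_p] := boolP (psi %| p); first by rewrite dvdp_mulr.
by rewrite Gauss_dvdpr // irreducible_poly_coprime.
Qed.

Lemma eqp_irreducible p q : p %= q -> irreducible_poly p -> irreducible_poly q.
Proof.
move=> pq p_irr; split; first by rewrite -(eqp_size pq) p_irr.1.
move=> h h_size; rewrite -(eqp_dvdr _ pq) => /(p_irr.2 _ h_size) hp.
exact: eqp_trans hp pq.
Qed.

Lemma irreducible_dvdX psi p n : irreducible_poly psi ->
  psi %| p ^+ n -> psi %| p.
Proof.
move=> irr; elim: n => [|n IHn].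
  by rewrite expr0 dvdp1 => /eqP s1; have := irr.1; rewrite s1.
by rewrite exprS irreducible_dvdM // => /orP[|/IHn].
Qed.

(** Peeling irreducible factors off [c] one at a time: a property of
    polynomials that behaves like divisibility by a prime holds for one of the
    irreducible factors.  It is used for vanishing at a point, and for
    divisibility after a substitution. *)
Lemma prime_irreducible_factor (P : {poly k} -> Prop) c :
    (forall a b, P (a * b) -> P a \/ P b) ->
    (forall x : k, x != 0 -> ~ P x%:P) -> c != 0 -> P c ->
  exists phi, [/\ irreducible_poly phi, phi %| c & P phi].
Proof.
move=> PM PC; have [n] := ubnP (size c).
elim: n c => // n IHn c size_c c0 Pc.
have size_c1 : (1 < size c)%N.
  rewrite ltnNge; apply/negP => /size1_polyC; move: (c`_0) => x cE.
  by move: c0 Pc; rewrite cE polyC_eq0 => /PC.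
have [irr|red] := pselect (irreducible_poly c).
  by exists c; rewrite dvdpp.
have [q [size_q q_dvd nq]] : exists q, [/\ size q != 1, q %| c & ~~ (q %= c)].
  apply: contrapT => none; apply: red; split=> // q size_q q_dvd.
  by apply: contrapT => /negP nq; apply: none; exists q.
move: (q_dvd) c0 size_c Pc => /dvdpP[b cE]; rewrite cE mulf_eq0 negb_or.
move=> /andP[b0 q0]; rewrite size_mul // => size_c.
have size_q1 : (1 < size q)%N by rewrite ltn_neqAle eq_sym size_q size_poly_gt0.
have size_b1 : (1 < size b)%N.
  rewrite ltnNge; apply: contra nq => /size1_polyC; move: (b`_0) => x bE.
  by move: b0; rewrite cE bE polyC_eq0 mul_polyC eqp_sym => /eqp_scale->.
have size_lt x y : ((x + y).-1 < n.+1)%N -> (1 < y)%N -> (x < n)%N by lia.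
case/PM=> [Pb|Pq].
  have [|phi [irr dvd Pphi]] := IHn b _ b0 Pb.
    exact: size_lt size_c size_q1.
  by exists phi; rewrite dvdp_mulr.
have [|phi [irr dvd Pphi]] := IHn q _ q0 Pq.
  by apply: size_lt size_b1; rewrite addnC.
by exists phi; rewrite dvdp_mull.
Qed.

Lemma irreducible_factor c : (1 < size c)%N ->
  exists2 phi, irreducible_poly phi & phi %| c.
Proof.
move=> size_c; have c0 : c != 0 by rewrite -size_poly_gt0 ltnW.
have [||phi [irr dvd _]] :=
  @prime_irreducible_factor (fun q => (1 < size q)%N) c _ _ c0 size_c.
- move=> a b; have [->|a0] := eqVneq a 0; first by rewrite mul0r size_poly0.
  have [->|b0] := eqVneq b 0; first by rewrite mulr0 size_poly0.
  rewrite size_mul // => size_ab; apply/orP; apply: contraLR size_ab.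
  by rewrite negb_or -!leqNgt => /andP[]; move: (size a) (size b); lia.
- by move=> x _; rewrite size_polyC; case: (x != 0).
- by exists phi.
Qed.

Lemma irreducible_factor_comp psi c h : irreducible_poly psi -> c != 0 ->
  psi %| c \Po h ->
  exists phi, [/\ irreducible_poly phi, phi %| c & psi %| phi \Po h].
Proof.
move=> irr; apply: prime_irreducible_factor => [a b|x x0].
  by rewrite comp_polyM irreducible_dvdM // => /orP.
rewrite comp_polyC => /dvdp_leq; rewrite polyC_eq0 size_polyC x0 => /(_ isT).
by rewrite leqNgt irr.1.
Qed.

Lemma irreducible_factor_root (l : fieldType) (s : {rmorphism k -> l}) c x :
    c != 0 -> root (map_poly s c) x ->
  exists phi, [/\ irreducible_poly phi, phi %| c & root (map_poly s phi) x].
Proof.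
apply: prime_irreducible_factor => [a b|y y0].
  by rewrite rmorphM rootM => /orP.
by rewrite map_polyC rootC fmorph_eq0 (negbTE y0).
Qed.

(** Two factors that acquire a common divisor after a substitution were not
    coprime before it. *)
Lemma irreducible_dvd_comp phi psi c h :
    irreducible_poly phi -> irreducible_poly psi ->
    psi %| phi \Po h -> psi %| c \Po h -> phi %| c.
Proof.
move=> irr_phi irr_psi dvd_phi dvd_c; apply: contraT => ndvd.
have : coprimep phi c by rewrite irreducible_poly_coprime.
move=> /(coprimep_comp_poly h)/coprimepP/(_ psi dvd_phi dvd_c).
by rewrite -size_poly_eq1 => /eqP s1; have := irr_psi.1; rewrite s1.
Qed.
End IrreducibleFactors.

(** * Polynomials over perfect fields of positive characteristic *)

Section PerfectField.
Variables (k : fieldType) (l : nat).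
Hypothesis char_l : l \in [pchar k].
Hypothesis frob_onto : forall y : k, exists x, y = x ^+ l.
Implicit Types c phi : {poly k}.

(** The monomials of a polynomial with zero derivative have exponents divisible
    by the characteristic, so each is an [l]-th power, and [l]-th powers are
    closed under addition. *)
Lemma deriv0_expr c : c^`() = 0 -> exists g, c = g ^+ l.
Proof.
have char_lX : l \in [pchar {poly k}] by rewrite pchar_poly.
have l_gt0 : (0 < l)%N := prime_gt0 (pcharf_prime char_l).
move=> dc0; rewrite -[c]coefK poly_def.
apply: (big_ind (fun q => exists g : {poly k}, q = g ^+ l)).
- by exists 0; rewrite expr0n; case: l l_gt0.
- move=> _ _ [g ->] [h ->]; exists (g + h).
  by rewrite -!(pFrobenius_autE char_lX) rmorphD.
- move=> i _; have [/dvdnP[j ij]|l_i] := boolP (l %| i)%N.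
    have [b bE] := frob_onto c`_i; exists (b *: 'X^j).
    by rewrite exprZn -exprM -ij bE.
  exists 0; rewrite expr0n eqn0Ngt l_gt0 /=.
  suff -> : c`_i = 0 by rewrite scale0r.
  case: (i : nat) l_i => [|j]; first by rewrite dvdn0.
  move=> l_j; have := congr1 (fun q : {poly k} => q`_j) dc0.
  rewrite coef_deriv coef0 -mulr_natr => /eqP.
  by rewrite mulf_eq0 -(dvdn_pcharf char_l) (negbTE l_j) orbF => /eqP.
Qed.

Lemma irreducible_deriv_neq0 phi : irreducible_poly phi -> phi^`() != 0.
Proof.
move=> irr; apply/eqP => /deriv0_expr[g gE].
have l_gt1 := prime_gt1 (pcharf_prime char_l).
have size_phi := irr.1.
have g_size : size g != 1.
  apply/eqP => g1; have := size_exp g l.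
  by rewrite g1 -gE mul0n; case: (size phi) size_phi => [|[|]].
have g_dvd : g %| phi by rewrite gE -(prednK (ltnW l_gt1)) exprS dvdp_mulr.
have /eqp_size g_phi := irr.2 g g_size g_dvd.
have := size_exp g l; rewrite -gE -g_phi.
by rewrite -g_phi in size_phi; move: (size g) size_phi l_gt1 => s; nia.
Qed.

(** Irreducible polynomials are separable here, so [phi] does not divide its
    own derivative, and must divide the cofactor of [phi] in [c]. *)
Lemma irreducible_dvd_sq phi c : irreducible_poly phi ->
  phi %| c -> phi %| c^`() -> phi ^+ 2 %| c.
Proof.
move=> irr /dvdpP[d ->]; rewrite derivM (dvdp_addr _ (dvdp_mull _ (dvdpp phi))) => dvd_d.
rewrite expr2 dvdp_mul //.
move: dvd_d; rewrite irreducible_dvdM // => /orP[//|/dvdp_leq].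
rewrite irreducible_deriv_neq0 // => /(_ isT).
by rewrite leqNgt lt_size_deriv // -size_poly_gt0 ltnW // irr.1.
Qed.

End PerfectField.

Lemma dvd_sq_deriv (k : fieldType) (psi c : {poly k}) :
  psi ^+ 2 %| c -> psi %| c^`().
Proof.
move=> /dvdpP[d ->]; rewrite derivM expr2 derivM.
have -> : d^`() * (psi * psi) + d * (psi^`() * psi + psi * psi^`()) =
          (d^`() * psi + d * psi^`() *+ 2) * psi by ring.
exact: dvdp_mulIr.
Qed.

(** * Singular points of a plane arithmetic curve *)

(** [red] is the reduction of a discrete valuation ring [A] modulo its
    uniformizer [pi]. *)
Definition uniformizer (A : comNzRingType) (k : fieldType) (red : A -> k)
    (pi : A) : Prop :=
  [/\ forall y, exists x, red x = y,
      forall x, red x = 0 <-> exists y, x = pi * y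
    & GRing.lreg pi].

Section Singular.
Variables (A : comNzRingType) (k : fieldType) (red : {rmorphism A -> k}).
Variable pi : A.
Hypothesis unif : uniformizer red pi.
Implicit Types u v w q : {poly A}.
Implicit Types phi psi c : {poly k}.
Local Notation "u ^r" := (map_poly red u) (at level 2, format "u ^r").

(** Membership of [q] in the square of the maximal ideal [(pi, psi)] of [A[x]];
    it says that [A[x]/(q)] is not regular at that ideal. *)
Definition singular_at psi q : Prop :=
  exists u v w, [/\ psi %| u^r, psi %| v^r, psi %| w^r & q = u * v + pi%:P * w].

Lemma red_pi : red pi = 0.
Proof. by case: unif => _ ker _; apply/ker; exists 1; rewrite mulr1. Qed.

Lemma red_poly_lift c : exists u, u^r = c.
Proof.
case: unif => surj _ _; have [s sE] := choice surj.
exists (\poly_(i < size c) s c`_i); apply/polyP => i.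
rewrite coef_map coef_poly; case: ltnP => [_|ci]; first exact: sE.
by rewrite raddf0 nth_default.
Qed.

Lemma red_poly_pi u : (pi%:P * u)^r = 0.
Proof. by rewrite rmorphM /= map_polyC /= red_pi mul0r. Qed.

Lemma red_poly_mod u v : (u + pi%:P * v)^r = u^r.
Proof. by rewrite rmorphD /= red_poly_pi addr0. Qed.

Lemma red_poly_ker u : u^r = 0 -> exists v, u = pi%:P * v.
Proof.
case: unif => _ ker _ u0.
have /choice[s sE] i : exists y, u`_i = pi * y.
  by apply/ker; rewrite -coef_map u0 coef0.
exists (\poly_(i < size u) s i); apply/polyP => i.
rewrite coefCM coef_poly; case: ltnP => [//|ui].
by rewrite mulr0 nth_default.
Qed.

Lemma pi_poly_inj u v : pi%:P * u = pi%:P * v -> u = v.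
Proof.
case: unif => _ _ reg e; apply/polyP => i; apply: reg.
by have := congr1 (fun q : {poly A} => q`_i) e; rewrite !coefCM.
Qed.

Lemma red_poly_eq u v : u^r = v^r -> exists w, u = v + pi%:P * w.
Proof.
move=> e; have [|w wE] := @red_poly_ker (u - v).
  by rewrite rmorphB /= e subrr.
by exists w; rewrite -wE addrC subrK.
Qed.

Lemma red_poly_dvd u d : d^r %| u^r -> exists a b, u = d * a + pi%:P * b.
Proof.
move=> /dvdpP[c cE]; have [a aE] := red_poly_lift c.
have [|b bE] := @red_poly_eq u (d * a); last by exists a, b.
by rewrite cE rmorphM /= mulrC aE.
Qed.

(** Any expression of [q] modulo the square of [psi] decides singularity:
    two such expressions differ by [psi^2 a + pi b] with [psi] dividing [b]
    modulo [pi]. *)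
Lemma singular_atE psi u v w : psi != 0 -> psi %| u^r -> psi %| v^r ->
  singular_at psi (u * v + pi%:P * w) <-> psi %| w^r.
Proof.
move=> psi0 psi_u psi_v; split=> [|psi_w]; last by exists u, v, w.
case=> u' [v' [w' [psi_u' psi_v' psi_w' e]]].
have [d dE] := red_poly_lift psi.
move: psi_u psi_v psi_u' psi_v'; rewrite -dE.
move=> /red_poly_dvd[a1 [b1 ?]] /red_poly_dvd[a2 [b2 ?]].
move=> /red_poly_dvd[a3 [b3 ?]] /red_poly_dvd[a4 [b4 ?]]; subst u v u' v'.
have : (a1 * a2 - a3 * a4)^r = 0.
  apply/eqP; rewrite -(mulrI_eq0 _ (mulfI (expf_neq0 2 psi0))) -dE -!rmorphXn.
  rewrite -rmorphM /=.
  have -> : d ^+ 2 * (a1 * a2 - a3 * a4) = pi%:P * (w' - w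
      + d * (a3 * b4 + b3 * a4 - a1 * b2 - b1 * a2)
      + pi%:P * (b3 * b4 - b1 * b2)).
    apply/eqP; rewrite -subr_eq0; move/eqP: e; rewrite -subr_eq0 => /eqP <-.
    by apply/eqP; ring.
  by rewrite red_poly_pi.
move=> /red_poly_ker[a'' aE].
have {e} : w = w' + d * (a3 * b4 + b3 * a4 - a1 * b2 - b1 * a2 - d * a'')
      + pi%:P * (b3 * b4 - b1 * b2).
  apply: pi_poly_inj; apply/eqP; rewrite -subr_eq0.
  have <- : d ^+ 2 * (pi%:P * a'' - (a1 * a2 - a3 * a4)) = 0.
    by rewrite aE subrr mulr0.
  move/eqP: e; rewrite -subr_eq0 => /eqP e.
  by rewrite -[X in _ == X]addr0 -e; apply/eqP; ring.
move=> ->; rewrite dE red_poly_mod rmorphD /= dvdp_add //.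
by rewrite rmorphM /= dE dvdp_mulr.
Qed.

Lemma singular_at_sq psi q : singular_at psi q -> psi ^+ 2 %| q^r.
Proof.
case=> u [v [w [psi_u psi_v _ ->]]].
by rewrite red_poly_mod rmorphM /= expr2 dvdp_mul.
Qed.

Lemma sq_dvd_decomp psi q : psi ^+ 2 %| q^r ->
  exists u v w, [/\ psi %| u^r, psi %| v^r & q = u * v + pi%:P * w].
Proof.
have [d dE] := red_poly_lift psi; rewrite -dE -rmorphXn /=.
case/red_poly_dvd=> a [b ->]; exists d, (d * a), b.
by rewrite rmorphM dvdpp dvdp_mulr // mulrA -expr2.
Qed.

(** A singular point of [F o h] lies over a singular point of [F]: write
    [F = u v + pi w]; then [F o h = (u o h)(v o h) + pi (w o h)]. *)
Lemma singular_at_comp phi psi F h :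
    irreducible_poly phi -> irreducible_poly psi ->
    phi ^+ 2 %| F^r -> psi %| phi \Po h^r ->
  singular_at psi (F \Po h) -> singular_at phi F.
Proof.
move=> irr_phi irr_psi /sq_dvd_decomp[u [v [w [phi_u phi_v ->]]]] dvd_h.
have dvd_comp (t : {poly A}) : phi %| t^r -> psi %| (t \Po h)^r.
  by rewrite map_comp_poly => /(dvdp_comp_poly h^r); apply: dvdp_trans.
rewrite comp_polyD !comp_polyM comp_polyC => /singular_atE.
move=> /(_ (irredp_neq0 irr_psi) (dvd_comp _ phi_u) (dvd_comp _ phi_v)).
rewrite map_comp_poly => dvd_w; apply/singular_atE => //.
  exact: irredp_neq0.
exact: irreducible_dvd_comp dvd_h dvd_w.
Qed.

End Singular.

(** * Dedekind's criterion *)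

(** The setting: [ev] is evaluation at a root [alpha] of a monic polynomial [q]
    over a discrete valuation ring [A] with fraction field [K]; it identifies
    [A[alpha]] with [A[x]/(q)], and [L = K(alpha)]. *)
Section Dedekind.
Variables (A : comNzRingType) (k : fieldType) (red : {rmorphism A -> k}).
Variables (pi : A) (L : fieldType) (iota : {rmorphism A -> L}).
Variables (alpha : L) (q : {poly A}) (ev : {rmorphism {poly A} -> L}).
Hypothesis unif : uniformizer red pi.
Hypothesis pi_neq0 : iota pi != 0.
Hypothesis q_monic : q \is monic.
Hypothesis evE : forall u, ev u = (map_poly iota u).[alpha].
Hypothesis ev_ker : forall u, ev u = 0 <-> exists s, u = q * s.
Hypothesis ev_gen : forall x : L, exists n u, iota pi ^+ n * x = ev u.
Implicit Types u v w : {poly A}.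
Local Notation "u ^r" := (map_poly red u) (at level 2, format "u ^r").

Let evC x : ev x%:P = iota x.
Proof. by rewrite evE map_polyC hornerC. Qed.

Let ev_q : ev q = 0.
Proof. by apply/ev_ker; exists 1; rewrite mulr1. Qed.

Let red_q_neq0 : q^r != 0.
Proof. by rewrite monic_neq0 // monic_map. Qed.

Let integral_ev u : integralOver iota (ev u).
Proof.
rewrite evE; apply: integral_horner.
  by apply/integral_poly => i; rewrite coef_map; apply: integral_id.
by exists q => //; apply/rootP; rewrite -evE.
Qed.

(** The equation of integral dependence of the fraction [gamma = u / v],
    cleared of denominators, is a multiple of [q]. *)
Let integral_fraction gamma u v : integralOver iota gamma ->
  ev u = gamma * ev v -> exists m t s, u ^+ m + v * t = q * s.
Proof.
case=> c c_monic /rootP c_root uv.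
have c_size : size c = (size c).-1.+1.
  by rewrite prednK // size_poly_gt0 monic_neq0.
set m := (size c).-1 in c_size.
exists m, (\sum_(i < m) (c`_i)%:P * u ^+ i * v ^+ (m - i.+1)); apply/ev_ker.
have -> : 0 = ev v ^+ m * (map_poly iota c).[gamma] by rewrite c_root mulr0.
rewrite horner_coef size_map_poly_id0; last first.
  by rewrite (monicP c_monic) rmorph1 oner_eq0.
rewrite c_size big_ord_recr coef_map /=.
have -> : c`_m = 1 by apply/eqP; rewrite -monicE.
rewrite rmorph1 mul1r rmorphD rmorphM rmorphXn rmorph_sum mulrDr addrC.
rewrite !mulr_sumr uv; congr (_ + _); last by rewrite exprMn mulrC.
apply: eq_bigr => i _; rewrite !rmorphM !rmorphXn evC uv coef_map exprMn /=.
have -> : ev v ^+ m = ev v * ev v ^+ (m - i.+1) * ev v ^+ i.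
  by rewrite -exprS -exprD; congr (_ ^+ _); rewrite addSn -addnS subnK.
by ring.
Qed.

(** If [A[x]/(q)] is regular then [A[alpha]] is integrally closed.  Suppose
    [beta] is integral and [pi beta = u(alpha)] with [beta] outside [A[alpha]].
    The numerators of integral fractions with denominator [pi] form an ideal,
    so the gcd [d] of [u] and [q] modulo [pi] lifts to such a numerator [D].
    A prime [psi] of [q / d] divides [d], because [q] divides a power of [d]
    modulo [pi].  Writing [q = D E + pi H], the integral element
    [D(alpha) / pi = - H(alpha) / E(alpha)] forces [psi] to divide [H] as
    well. *)
Lemma regular_integral_closed :
    (forall psi, irreducible_poly psi -> ~ singular_at red pi psi q) ->
  forall beta, integralOver iota beta -> exists u, beta = ev u.
Proof.
move=> regular beta; have [n [u]] := ev_gen beta.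
elim: n beta u => [|n IHn] beta u; first by rewrite mul1r; exists u.
rewrite exprSr -mulrA => /IHn step beta_int.
have {step u} [|u uE] := step.
  by apply: integral_mul beta_int; apply: integral_id.
apply: contrapT => beta_out.
have q_ndvd_u : ~~ (q^r %| u^r).
  apply/negP => /(red_poly_dvd unif)[s [t ut]]; apply: beta_out; exists t.
  apply: (mulfI pi_neq0); rewrite uE ut rmorphD !rmorphM ev_q mul0r add0r.
  by rewrite evC.
have [[a b] /= abE] := Bezoutp u^r q^r.
have [ua uaE] := red_poly_lift unif a; have [ub ubE] := red_poly_lift unif b.
pose d := u * ua + q * ub.
have dE : d^r %= gcdp u^r q^r.
  apply: eqp_trans abE; rewrite rmorphD !rmorphM /= uaE ubE mulrC [_ * b]mulrC.
  exact: eqpxx.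
have d_dvd_q : d^r %| q^r by rewrite (eqp_dvdl _ dE) dvdp_gcdr.
have d_dvd_u : d^r %| u^r by rewrite (eqp_dvdl _ dE) dvdp_gcdl.
pose gamma := beta * ev ua.
have gamma_int : integralOver iota gamma.
  by apply: integral_mul (integral_ev _).
have d_gamma : ev d = gamma * ev pi%:P.
  by rewrite rmorphD !rmorphM ev_q mul0r addr0 -uE evC /gamma; ring.
have [e eE] := dvdpP _ _ d_dvd_q.
have e_neq0 : e != 0 by apply: contraNneq red_q_neq0 => e0; rewrite eE e0 mul0r.
have e_size : (1 < size e)%N.
  rewrite ltnNge; apply: contra q_ndvd_u => /size1_polyC; move: e`_0 => x ex.
  move: e_neq0; rewrite eE ex mul_polyC polyC_eq0 => x0.
  by rewrite (eqp_dvdl _ (eqp_scale _ x0)).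
have [psi psi_irr psi_e] := irreducible_factor e_size.
have psi_q : psi %| q^r by rewrite eE dvdp_mulr.
have psi_d : psi %| d^r.
  have [m [t [s ms]]] := integral_fraction gamma_int d_gamma.
  apply: (@irreducible_dvdX _ _ _ m) => //.
  have -> : d^r ^+ m = q^r * s^r.
    have := congr1 (map_poly red) ms.
    by rewrite (red_poly_mod unif) rmorphXn rmorphM.
  by rewrite dvdp_mulr.
have [e' e'E] := red_poly_lift unif e; rewrite -e'E in psi_e.
have [|h hE] := @red_poly_eq _ _ _ _ unif q (d * e').
  by rewrite rmorphM /= e'E mulrC.
apply: (regular psi psi_irr); rewrite hE.
apply/singular_atE => //; first exact: irredp_neq0.
have h_gamma : ev (- h) = gamma * ev e'.
  apply: (mulfI pi_neq0); rewrite -evC rmorphN.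
  have := ev_q; rewrite hE rmorphD !rmorphM d_gamma => /eqP.
  by rewrite addr_eq0 => /eqP e1; rewrite mulrN -e1; ring.
have [m [t [s ms]]] := integral_fraction gamma_int h_gamma.
have {ms} : (- h)^r ^+ m = q^r * s^r - e'^r * t^r.
  have := congr1 (map_poly red) ms; rewrite rmorphD rmorphXn !rmorphM /= => <-.
  by rewrite addrK.
rewrite -dvdpNr -rmorphN => hm; apply: (@irreducible_dvdX _ _ _ m) => //.
by rewrite hm dvdp_sub // dvdp_mulr.
Qed.

(** Conversely, if [q = psi^2 c + pi h] with [psi] dividing [h] modulo [pi],
    then [psi(alpha) c(alpha) / pi] is integral: its square is a combination of
    itself and [1].  It is outside [A[alpha]] because [psi c] has smaller degree
    than [q] modulo [pi]. *)
Lemma singular_not_closed psi : irreducible_poly psi ->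
    singular_at red pi psi q ->
  exists2 beta, integralOver iota beta & ~ exists u, beta = ev u.
Proof.
move=> psi_irr sing; have [d dE] := red_poly_lift unif psi.
have := singular_at_sq unif sing; rewrite -dE -rmorphXn.
case/(red_poly_dvd unif)=> c [h qE].
have : psi %| h^r.
  apply/(@singular_atE _ _ _ _ unif psi d (d * c)); rewrite ?irredp_neq0 //.
  - by rewrite dE.
  - by rewrite rmorphM /= dE dvdp_mulr.
  - by rewrite mulrA -expr2 -qE.
rewrite -dE => /(red_poly_dvd unif)[h1 [h2 hE]].
have [beta betaE] : exists beta, beta * iota pi = ev d * ev c.
  by exists (ev d * ev c / iota pi); rewrite divfK.
exists beta; last first.
  case=> w wE; have [|s sE] := (ev_ker (d * c - pi%:P * w)).1.
    by rewrite rmorphB !rmorphM evC -wE [_ * beta]mulrC betaE subrr.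
  have : q^r %| (d * c)^r.
    rewrite -[d * c](subrK (pi%:P * w)) sE (red_poly_mod unif).
    by rewrite rmorphM dvdp_mulr.
  have -> : q^r = psi * (d * c)^r.
    by rewrite qE (red_poly_mod unif) expr2 -mulrA rmorphM /= dE.
  have dc0 : (d * c)^r != 0.
    apply: contraNneq red_q_neq0 => dc0.
    by rewrite qE (red_poly_mod unif) expr2 -mulrA rmorphM /= dc0 mulr0.
  move=> /(dvdp_leq dc0); rewrite size_mul ?(irredp_neq0 psi_irr) //.
  move: dc0 psi_irr.1; rewrite -size_poly_gt0.
  by move: (size psi) (size _) => x y; lia.
pose c2 : {poly L} := 'X^2 + (ev h1 *: 'X + (ev (c * h2))%:P).
apply: (@integral_root_monic _ _ _ _ c2).
- rewrite monicE lead_coefDl ?lead_coefXn // size_polyXn.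
  apply: leq_ltn_trans (size_polyD _ _) _.
  rewrite gtn_max size_polyC (leq_ltn_trans (size_scale_leq _ _)) ?size_polyX //.
  by case: (_ != 0).
- apply/rootP; rewrite /c2 !(hornerD, hornerXn, hornerZ, hornerX, hornerC).
  apply: (mulfI (expf_neq0 2 pi_neq0)); rewrite mulr0.
  have eqq : ev d ^+ 2 * ev c + iota pi * (ev d * ev h1 + iota pi * ev h2) = 0.
    by rewrite -ev_q qE hE !rmorphD !rmorphM rmorphD !rmorphM !evC.
  rewrite -[RHS](mulr0 (ev c)) -eqq.
  have -> : iota pi ^+ 2 * (beta ^+ 2 + (ev h1 * beta + ev (c * h2))) =
    (beta * iota pi) ^+ 2 + iota pi * ev h1 * (beta * iota pi)
      + iota pi ^+ 2 * ev (c * h2) by ring.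
  by rewrite betaE rmorphM; ring.
- apply/integral_poly => i; rewrite /c2 !coefE.
  have natI n : integralOver iota n%:R := integral_nat _ n.
  apply: integral_add; first exact: natI.
  apply: integral_add; first exact: integral_mul (integral_ev _) (natI _).
  by case: ifP => _; [exact: integral_ev | exact: (natI 0%N)].
Qed.

End Dedekind.

(** * The local ring of a number field at a prime *)

(** Characteristic zero and finite dimension over the rationals, in the form
    in which they are used: every family of some fixed size satisfies a
    nontrivial integral linear relation. *)
Definition number_field (F : fieldType) : Prop :=
  (forall c : int, c%:~R = 0 :> F -> c = 0) /\
  exists d, forall x : 'I_d -> F, exists c : 'I_d -> int,
    (exists i, c i != 0) /\ \sum_i (c i)%:~R * x i = 0.

Lemma number_field_rat (L : fieldExtType rat) : number_field L.
Proof.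
have charL (c : int) : (c%:~R = 0 :> L) -> c = 0.
  rewrite -(rmorph_int (in_alg L)) => /eqP; rewrite fmorph_eq0 intr_eq0.
  by move/eqP.
split=> //; exists (\dim {:L}).+1 => x.
pose X := [tuple x i | i < (\dim {:L}).+1].
have nfree : ~~ free X.
  apply/negP => /eqP; rewrite size_tuple => Xdim.
  by have := dimvS (subvf <<X>>); rewrite Xdim ltnn.
have [k [k_rel [i ki]]] : exists k : 'I_(\dim {:L}).+1 -> rat,
    \sum_j k j *: X`_j = 0 /\ exists i, k i != 0.
  apply: contrapT => none; case/negP: nfree; apply/freeP => k k_rel i.
  by apply: contrapT => /eqP ki; apply: none; exists k; split=> //; exists i.
pose D := \prod_j denq (k j).
have D_div j : exists c, D%:~R * k j = c%:~R :> rat.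
  exists ((\prod_(h | h != j) denq (k h)) * numq (k j)).
  by rewrite /D (bigD1 j) //= !rmorphM /= numqE; ring.
have [c cE] := choice D_div; exists c; split.
  exists i; apply: contraNneq ki => ci.
  have := cE i; rewrite ci => /eqP; rewrite mulf_eq0 intr_eq0 => /orP[|//].
  by move=> /prodf_eq0[j _]; rewrite denq_eq0.
transitivity (D%:~R *: (\sum_j k j *: X`_j)); last by rewrite k_rel scaler0.
rewrite scaler_sumr; apply: eq_bigr => j _.
rewrite scalerA cE -(rmorph_int (in_alg L)) /=.
by rewrite -(tnth_nth 0 X j) tnth_mktuple mulr_algl.
Qed.

Lemma number_field_ext (K : fieldExtType rat) (M : fieldExtType K) :
  number_field M.
Proof. exact: (number_field_rat (baseFieldType M)). Qed.

Section LocalRing.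
Variables (F : fieldType) (P : nzPrime F).
Local Notation PI := (P : prime_idealr 'O_F).
Local Notation loc := (local_ring P).
Local Notation max := (local_max_ideal P).
Implicit Types x y : F.

Lemma local_ringP x : reflect
  (exists a s : 'O_F, s \notin PI /\ x = val a / val s) (x \in loc).
Proof. exact: asboolP. Qed.

Lemma local_max_idealP x : reflect
  (exists a s : 'O_F, [/\ a \in PI, s \notin PI & x = val a / val s]) (x \in max).
Proof. exact: asboolP. Qed.

Lemma notin_prime_neq0 (s : 'O_F) : s \notin PI -> val s != 0.
Proof.
apply: contraNneq => s0; suff -> : s = 0 by exact: idealr0.
by apply: val_inj; rewrite s0 rmorph0.
Qed.

Lemma notin_primeM (s t : 'O_F) : s \notin PI -> t \notin PI -> s * t \notin PI.
Proof. by rewrite -!reduce_eq0 rmorphM mulf_eq0 negb_or => -> ->. Qed.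

Lemma notin_prime1 : (1 : 'O_F) \notin PI.
Proof. by rewrite -reduce_eq0 rmorph1 oner_eq0. Qed.

Lemma local_ring_subring : subring_closed loc.
Proof.
split.
- apply/local_ringP; exists 1, 1; split; first exact: notin_prime1.
  by rewrite rmorph1 divr1.
- move=> x y /local_ringP[a [s [sP ->]]] /local_ringP[b [t [tP ->]]].
  apply/local_ringP; exists (a * t - b * s), (s * t).
  split; first exact: notin_primeM.
  rewrite -mulNr addf_div ?notin_prime_neq0 //.
  by rewrite rmorphB !rmorphM mulNr.
- move=> x y /local_ringP[a [s [sP ->]]] /local_ringP[b [t [tP ->]]].
  apply/local_ringP; exists (a * b), (s * t); split; first exact: notin_primeM.
  by rewrite !rmorphM mulf_div.
Qed.

HB.instance Definition _ := GRing.isSubringClosed.Build F loc local_ring_subring.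

(** The localization as a type, so as to form polynomials over it. *)
Record localInt := LocalInt
  { localInt_val :> F; _ : localInt_val \in loc }.

HB.instance Definition _ := [isSub for localInt_val].
HB.instance Definition _ := [Choice of localInt by <:].
HB.instance Definition _ := [SubChoice_isSubComNzRing of localInt by <:].

Lemma int_local_proof (a : 'O_F) : val a \in loc.
Proof.
apply/local_ringP; exists a, 1; split; first exact: notin_prime1.
by rewrite rmorph1 divr1.
Qed.

Definition int_local (a : 'O_F) : localInt := LocalInt (int_local_proof a).

Fact int_local_zmod : zmod_morphism int_local.
Proof.
move=> a b; apply: val_inj; rewrite rmorphB.
exact: (rmorphB (val : 'O_F -> F)).
Qed.
Fact int_local_monoid : monoid_morphism int_local.
Proof.
split=> [|a b]; apply: val_inj; rewrite ?rmorph1 ?rmorphM.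
  exact: (rmorph1 (val : 'O_F -> F)).
exact: (rmorphM (val : 'O_F -> F)).
Qed.
HB.instance Definition _ :=
  GRing.isZmodMorphism.Build 'O_F localInt int_local int_local_zmod.
HB.instance Definition _ :=
  GRing.isMonoidMorphism.Build 'O_F localInt int_local int_local_monoid.

Definition local_red (x : localInt) : residue P := local_reduce P (val x).

Lemma local_redE (x : localInt) (a s : 'O_F) : s \notin PI ->
  val x = val a / val s -> local_red x = reduce P a / reduce P s.
Proof. by move=> sP xE; rewrite /local_red xE local_reduceE. Qed.

Fact local_red_zmod : zmod_morphism local_red.
Proof.
move=> x y; have /local_ringP[a [s [sP xE]]] := valP x.
have /local_ringP[b [t [tP yE]]] := valP y.
rewrite (local_redE sP xE) (local_redE tP yE).
have sR : reduce P s != 0 by rewrite reduce_eq0.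
have tR : reduce P t != 0 by rewrite reduce_eq0.
rewrite -mulNr addf_div // mulNr -!rmorphM -rmorphB.
apply: local_redE; first exact: notin_primeM.
transitivity (val x - val y); first exact: (rmorphB (val : localInt -> F)).
rewrite xE yE -mulNr addf_div ?notin_prime_neq0 //.
by rewrite rmorphB !rmorphM mulNr.
Qed.
Fact local_red_monoid : monoid_morphism local_red.
Proof.
split=> [|x y].
  rewrite (@local_redE _ 1 1) ?notin_prime1 ?rmorph1 ?divr1 //.
have /local_ringP[a [s [sP xE]]] := valP x.
have /local_ringP[b [t [tP yE]]] := valP y.
rewrite (local_redE sP xE) (local_redE tP yE) mulf_div -!rmorphM.
apply: local_redE; first exact: notin_primeM.
transitivity (val x * val y); first exact: (rmorphM (val : localInt -> F)).
by rewrite xE yE !rmorphM mulf_div.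
Qed.
HB.instance Definition _ :=
  GRing.isZmodMorphism.Build localInt (residue P) local_red local_red_zmod.
HB.instance Definition _ :=
  GRing.isMonoidMorphism.Build localInt (residue P) local_red local_red_monoid.

Lemma local_red_int (a : 'O_F) : local_red (int_local a) = reduce P a.
Proof. by rewrite (@local_redE _ a 1) ?notin_prime1 //= ?rmorph1 ?divr1. Qed.

Lemma local_red_surj (y : residue P) : exists x : localInt, local_red x = y.
Proof.
by have [a <-] := reduce_surj y; exists (int_local a); rewrite local_red_int.
Qed.

Lemma local_red_eq0 (x : localInt) : (local_red x == 0) = (val x \in max).
Proof.
apply/eqP/local_max_idealP => [x0|[a [s [aP sP xE]]]].
  have /local_ringP[a [s [sP xE]]] := valP x; exists a, s; split=> //.
  move/eqP: x0; rewrite (local_redE sP xE) mulf_eq0 invr_eq0 !reduce_eq0.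
  by rewrite (negbTE sP) orbF.
by rewrite (local_redE sP xE); move: aP; rewrite -reduce_eq0 => /eqP->; rewrite mul0r.
Qed.

Lemma max_local x : x \in max -> x \in loc.
Proof.
by case/local_max_idealP=> a [s [aP sP ->]]; apply/local_ringP; exists a, s.
Qed.

Lemma maxP x : reflect (exists2 y : localInt, x = val y & local_red y = 0)
  (x \in max).
Proof.
apply: (iffP idP) => [xP|[y -> /eqP]]; last by rewrite local_red_eq0.
by exists (LocalInt (max_local xP)) => //; apply/eqP; rewrite local_red_eq0.
Qed.

Lemma max0 : 0 \in max.
Proof. by apply/maxP; exists 0; rewrite ?rmorph0. Qed.

Lemma maxD x y : x \in max -> y \in max -> x + y \in max.
Proof.
case/maxP=> u -> u0 /maxP[v -> v0]; apply/maxP.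
by exists (u + v); rewrite rmorphD //= u0 v0 addr0.
Qed.

Lemma maxMl x y : x \in loc -> y \in max -> x * y \in max.
Proof.
move=> xl /maxP[v -> v0]; apply/maxP.
by exists (LocalInt xl * v); rewrite rmorphM //= v0 mulr0.
Qed.

Lemma maxMr x y : x \in max -> y \in loc -> x * y \in max.
Proof. by move=> xm yl; rewrite mulrC maxMl. Qed.

Lemma maxN x : x \in max -> - x \in max.
Proof.
case/maxP=> u -> u0; apply/maxP.
by exists (- u); rewrite rmorphN //= u0 oppr0.
Qed.

Lemma max1 : 1 \notin max.
Proof.
apply/maxP => -[y /esym y1].
have -> : y = 1 by apply: val_inj; rewrite y1 rmorph1.
by rewrite rmorph1 => /eqP; rewrite oner_eq0.
Qed.

Lemma local_inv x : x \in loc -> x \notin max -> x^-1 \in loc.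
Proof.
case/local_ringP=> a [s [sP ->]] nx; rewrite invf_div; apply/local_ringP.
exists s, a; split=> //; apply: contra nx => aP; apply/local_max_idealP.
by exists a, s.
Qed.

Lemma localInt_inv (x : localInt) : local_red x != 0 -> exists y : localInt, x * y = 1.
Proof.
move=> x0; have nx : val x \notin max by rewrite -local_red_eq0.
exists (LocalInt (local_inv (valP x) nx)); apply: val_inj.
rewrite [LHS](rmorphM (val : localInt -> F)) [RHS](rmorph1 (val : localInt -> F)).
by apply: divff; apply: contraNneq nx => ->; apply: max0.
Qed.

Lemma max_inv_notin x : x != 0 -> x^-1 \in max -> x \notin loc.
Proof.
move=> x0 xV; apply: contra max1 => xl.
by rewrite -(mulVf x0) maxMr.
Qed.

Lemma ringInt_in_max (a : 'O_F) : (val a \in max) = (a \in PI).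
Proof. by rewrite -[val a]/(val (int_local a)) -local_red_eq0 local_red_int reduce_eq0. Qed.

Lemma max_prime_associate x : x \in max -> exists2 b, b \in PI &
  exists2 u, (u \in loc) && (u^-1 \in loc) & x = val b * u.
Proof.
case/local_max_idealP=> b [s [bP sP ->]]; exists b => //.
exists (val s)^-1 => //; rewrite invrK int_local_proof andbT.
by apply: local_inv; rewrite ?int_local_proof // ringInt_in_max.
Qed.

End LocalRing.

(** * Number fields have discrete valuation rings *)

(** Multiply the equation [g(x) = 0] by the power of the leading coefficient [c]
    that turns it into a monic equation for [c x]. *)
Lemma integral_lead_coef (R : comNzRingType) (F : fieldType)
    (iota : {rmorphism R -> F}) (g : {poly R}) (x : F) : (1 < size g)%N ->
  root (map_poly iota g) x -> integralOver iota (iota (lead_coef g) * x).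
Proof.
move=> g_size /rootP gx; set c := lead_coef g; pose n := (size g).-2.
have g_sizeE : size g = n.+2 by rewrite /n; case: (size g) g_size => [|[|]].
pose low := \poly_(i < n.+1) (g`_i * c ^+ (n - i)).
have low_size : (size low < size ('X^(n.+1) : {poly R}))%N.
  by rewrite size_polyXn ltnS size_poly.
exists ('X^(n.+1) + low); first by rewrite monicE lead_coefDl // lead_coefXn.
apply/rootP; rewrite rmorphD /= map_polyXn hornerD hornerXn.
have -> : 0 = iota c ^+ n * (map_poly iota g).[x] by rewrite gx mulr0.
rewrite (@horner_coef_wide _ n.+1 (map_poly iota low)); last first.
  exact: leq_trans (size_poly _ _) (size_poly _ _).
rewrite (@horner_coef_wide _ n.+2 (map_poly iota g)); last first.
  by rewrite -g_sizeE size_poly.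
rewrite [in RHS]big_ord_recr /= mulrDr addrC; congr (_ + _); last first.
  rewrite coef_map /= -[n.+1]/(n.+2.-1) -g_sizeE -lead_coefE -/c.
  by rewrite g_sizeE exprMn exprSr mulrA.
rewrite mulr_sumr; apply: eq_bigr => i _.
rewrite !coef_map coef_poly ltn_ord /= rmorphM rmorphXn exprMn.
have -> : iota c ^+ n = iota c ^+ (n - i) * iota c ^+ i.
  by rewrite -exprD subnK // -ltnS.
by ring.
Qed.

Lemma integral_integers (F : fieldType) (x : F) :
  integralOver (val : 'O_F -> F) x -> x \in integers F.
Proof.
case=> q q_monic qx; apply/integersP.
apply: integral_root_monic qx _; first by rewrite monic_map.
apply/integral_poly => i; rewrite coef_map; exact/integersP/valP.
Qed.

Section ValuationRing.
Variables (F : fieldType) (P : nzPrime F).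
Hypothesis nfF : number_field F.
Local Notation PI := (P : prime_idealr 'O_F).
Local Notation loc := (local_ring P).
Local Notation max := (local_max_ideal P).
Implicit Types x y : F.

(** A nonzero prime contains a nonzero integer, namely a multiple of any of its
    nonzero elements. *)
Lemma residue_char : exists l, l \in [pchar (residue P)].
Proof.
have [z [z0 zP]] := nzPrime_neq0 P.
have domO : no_zero_div 'O_F by move=> a b /eqP; rewrite mulf_eq0.
have [n [t [n0 nE]]] := integral_multiple domO z0 (ringInt_integral z).
have n1 : (0 < `|n|)%N.
  by rewrite absz_gt0; apply: contraNneq n0 => ->.
apply: (natf0_pchar n1); rewrite -(rmorph_nat (reduce P)) reduce_eq0.
have : (n%:~R : 'O_F) \in PI by rewrite nE idealMr.
case: n {n0 nE n1} => m //=; rewrite NegzE mulrNz.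
by rewrite -reduce_eq0 rmorphN oppr_eq0 reduce_eq0.
Qed.

Variable l : nat.
Hypothesis char_l : l \in [pchar (residue P)].

Let l_prime : prime l := pcharf_prime char_l.

Lemma int_in_prime (c : int) : (c%:~R \in PI) = (l %| `|c|)%N.
Proof.
rewrite -reduce_eq0 rmorph_int (dvdn_pcharf char_l).
by case: c => m //=; rewrite NegzE mulrNz oppr_eq0.
Qed.

Lemma int_in_max (c : int) : (c%:~R \in max) = (l %| `|c|)%N.
Proof.
by rewrite -int_in_prime -ringInt_in_max rmorph_int.
Qed.

(** Dividing by [l] as long as possible, an integral relation may be taken
    nontrivial modulo [l]. *)
Lemma primitive_relation : exists d, forall x : 'I_d -> F,
  exists c : 'I_d -> int, (exists i, ~~ (l %| `|c i|)%N) /\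
    \sum_i (c i)%:~R * x i = 0.
Proof.
case: nfF => char0 [d dE]; exists d => x; have [c [[i ci] c_rel]] := dE x.
have [n] := ubnP `|c i|%N; elim: n c ci c_rel => // n IHn c ci c_rel ci_n.
have [all_l|] := pselect (forall j, (l %| `|c j|)%N); last first.
  by move/existsNP => [j /negP cj]; exists c; split=> //; exists j.
have /choice[c' c'E] j : exists e : int, c j = l%:Z * e.
  by have /dvdzP[e ->] : (l %| c j)%Z := all_l j; exists e; rewrite mulrC.
have l_gt1 := prime_gt1 l_prime.
apply: (IHn c').
- by apply: contraNneq ci => ci'; rewrite c'E ci' mulr0.
- have l0 : (l%:Z)%:~R != 0 :> F.
    by apply/eqP => /char0 l0; move: l_gt1; case: l l0.
  apply: (mulfI l0); rewrite mulr0 -[RHS]c_rel mulr_sumr.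
  by apply: eq_bigr => j _; rewrite c'E rmorphM mulrA.
- move: ci_n ci; rewrite c'E abszM mulf_eq0 negb_or -absz_gt0 => ci_n /andP[_].
  by rewrite -absz_gt0; move: l_gt1 ci_n; rewrite absz_nat; nia.
Qed.

(** [loc] is a valuation ring.  Let [c] be the leading coefficient of a
    polynomial [g] over the integers that vanishes at [x], with some coefficient
    outside [P].  Then [c x] is an integer, so if [c] and [c x] are not both in
    [P] then [x = (c x) / c] settles the matter; otherwise the leading
    term [c X^n] may be replaced by [(c x) X^(n-1)], which lowers the degree. *)
Lemma local_or_inv_poly (g : {poly 'O_F}) x i : root (map_poly val g) x ->
  g`_i \notin PI -> (x \in loc) || (x^-1 \in max).
Proof.
have [n] := ubnP (size g); elim: n g i => // n IHn g i g_n gx gi.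
have g_size : (1 < size g)%N.
  rewrite ltnNge; apply/negP => /size1_polyC; move: g`_0 => b gE.
  move: gx; rewrite gE map_polyC rootC => /eqP b0.
  move: gi; rewrite gE coefC; case: ifP => _; last by rewrite idealr0.
  by move=> /notin_prime_neq0; rewrite b0 eqxx.
set c := lead_coef g; pose b := RingInt (integral_integers (integral_lead_coef g_size gx)).
have bE : val b = val c * x by [].
have c0 : val c != 0.
  rewrite (inj_eq val_inj c 0) lead_coef_eq0 -size_poly_gt0.
  exact: ltnW.
have xE : x = val b / val c by rewrite bE mulrC mulKf.
have [cP|cP] := boolP (c \in PI); last first.
  by apply/orP; left; apply/local_ringP; exists b, c.
have [bP|bP] := boolP (b \in PI); last first.
  apply/orP; right; rewrite xE invf_div; apply/local_max_idealP.
  by exists c, b.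
pose m := (size g).-1; have m_gt0 : (0 < m)%N by rewrite /m; lia.
pose h := g - c *: 'X^m + b *: 'X^(m.-1).
have red_h j : reduce P h`_j = reduce P g`_j.
  have cR : reduce P c = 0 by apply/eqP; rewrite reduce_eq0.
  have bR : reduce P b = 0 by apply/eqP; rewrite reduce_eq0.
  by rewrite !coefE rmorphD rmorphB !rmorphM /= cR bR !mul0r subr0 addr0.
apply: (IHn h i).
- apply: leq_trans (_ : size h < size g)%N g_n.
  rewrite -(prednK (ltnW g_size)) -/m ltnS.
  apply/leq_sizeP => j; rewrite leq_eqVlt => /orP[/eqP <-|mj].
    rewrite !coefE eqxx -lead_coefE mulr1 subrr add0r.
    by case: eqP => [|_]; [lia | rewrite mulr0].
  rewrite !coefE nth_default; last by rewrite -(prednK (ltnW g_size)).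
  by do 2![case: eqP => [|_]; first by lia]; rewrite !mulr0 subr0 addr0.
- have h_eval (iota : {rmorphism 'O_F -> F}) : (map_poly iota h).[x] =
      (map_poly iota g).[x] - iota c * x ^+ m + iota b * x ^+ m.-1.
    rewrite /h rmorphD rmorphB /= !map_polyZ !map_polyXn.
    by rewrite !(hornerD, hornerN, hornerZ, hornerXn).
  have {}h_eval : (map_poly val h).[x] =
      (map_poly val g).[x] - val c * x ^+ m + val b * x ^+ m.-1 := h_eval _.
  apply/rootP; rewrite h_eval (rootP gx) bE sub0r -mulrA -exprS prednK //.
  by rewrite addNr.
- by rewrite -reduce_eq0 red_h reduce_eq0.
Qed.

Lemma local_or_inv x : (x \in loc) || (x^-1 \in max).
Proof.
have [d dE] := primitive_relation; have [c [[i ci] c_rel]] := dE (fun i => x ^+ i).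
pose g : {poly 'O_F} := \poly_(j < d) oapp (fun j => (c j)%:~R) 0 (insub j).
have gE (j : 'I_d) : g`_j = (c j)%:~R.
  by rewrite coef_poly ltn_ord insubT //= => lt; congr (c _)%:~R; apply: val_inj.
apply: (@local_or_inv_poly g x i); last by rewrite gE int_in_prime.
apply/rootP; rewrite -[RHS]c_rel.
rewrite (horner_coef_wide _ (_ : _ <= d)%N); last first.
  exact: leq_trans (size_poly _ _) (size_poly _ _).
apply: eq_bigr => j _; rewrite coef_map gE; congr (_ * _).
exact: (rmorph_int (val : 'O_F -> F)).
Qed.

(** A strictly descending chain of divisors of [l] in [loc] is linearly
    independent over the rationals: in a relation that is primitive at [l], the
    first term with a coefficient prime to [l] strictly dominates all others.
    This bounds the length of such chains. *)
Lemma divisor_chain_bound : exists d, forall x : nat -> F,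
    (forall i, (i < d)%N -> x i \in loc) ->
    (forall i, (i < d)%N -> x i != 0) ->
    (forall i j, (i < j < d)%N -> x j / x i \in max) ->
  ~ forall i, (i < d)%N -> l%:R / x i \in max.
Proof.
have [d dE] := primitive_relation; exists d => x x_loc x_neq0 x_chain x_l.
have [c [ex_c c_rel]] := dE (fun i => x i).
have ex_n : exists n, [exists i : 'I_d, (i == n :> nat) && ~~ (l %| `|c i|)%N].
  by have [i ci] := ex_c; exists i; apply/existsP; exists i; rewrite eqxx.
(* The coefficients before the [i]-th one are multiples of [l], and those terms
   are dominated by the [i]-th one because [l / x i] is in the ideal. *)
case: (ex_minnP ex_n) => n /existsP[i /andP[/eqP <- ci]] i_min.
have c_lt (j : 'I_d) : (j < i)%N -> (l %| `|c j|)%N.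
  rewrite ltnNge; apply: contraNT => cj; apply: i_min.
  by apply/existsP; exists j; rewrite eqxx.
case/negP: ci; rewrite -int_in_max.
move: c_rel; rewrite (bigD1 i) //= => /eqP; rewrite addr_eq0 => /eqP c_rel.
have -> : (c i)%:~R = - \sum_(j | j != i) (c j)%:~R * x j / x i.
  by rewrite -mulr_suml -mulNr -c_rel mulfK // x_neq0.
have int_loc (z : int) : z%:~R \in loc := rpred_int _ z.
apply: maxN; apply: (big_ind (fun y => y \in max)); [exact: max0 | exact: maxD|].
move=> j ji; have [ij|ji'] := ltnP i j.
  by rewrite -mulrA maxMl // x_chain // ij ltn_ord.
have {ji' ji}/c_lt/dvdnP[e ce] : (j < i)%N by rewrite ltn_neqAle ji.
have [e' ->] : exists e' : int, (c j)%:~R = e'%:~R * l%:R :> F.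
  exists ((-1) ^+ (c j < 0)%R * e%:Z).
  by rewrite [in LHS](intEsign (c j)) ce PoszM !rmorphM /= -mulrA.
have -> : e'%:~R * l%:R * x j / x i = (e'%:~R * x j) * (l%:R / x i) by ring.
by rewrite maxMl // ?x_l // rpredM ?x_loc.
Qed.

Lemma char_in_max : l%:R \in max.
Proof. by have := int_in_max l; rewrite dvdnn. Qed.

Lemma char_neq0 : l%:R != 0 :> F.
Proof.
apply/eqP => l0; have [char0 _] := nfF.
by have := char0 l l0 => -[l0']; have := prime_gt0 l_prime; rewrite l0'.
Qed.

(** If no element generated the maximal ideal, every nonzero element of it would
    be a proper multiple of another one.  Iterating from [l] would yield arbitrarily
    long chains of divisors of [l]. *)
Lemma max_principal : exists x, [/\ x \in max, x != 0 &
  forall y, y \in max -> y / x \in loc].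
Proof.
apply: contrapT => none.
have /choice[next nextE] x : exists y, x \in max -> x != 0 ->
    [/\ y \in max, y != 0 & x / y \in max].
  have [[xm x0]|nx] := pselect (x \in max /\ x != 0); last first.
    by exists 0 => xm x0; case: nx.
  apply: contrapT => nogood; apply: none; exists x; split=> // y ym.
  apply: contraT => yx; have yx0 : y != 0.
    by apply: contraNneq yx => ->; rewrite mul0r rpred0.
  case: nogood; exists y => _ _; split=> //.
  by have := local_or_inv (y / x); rewrite (negbTE yx) invf_div.
have iter_ok n : iter n next l%:R \in max /\ iter n next l%:R != 0.
  elim: n => [|n [IHm IH0]] /=; first by rewrite char_in_max char_neq0.
  by have [] := nextE _ IHm IH0.
have iter_chain n m : iter n next l%:R / iter (n + m.+1) next l%:R \in max.
  elim: m => [|m IHm].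
    by rewrite addn1 /=; have [a b] := iter_ok n; have [] := nextE _ a b.
  have [a b] := iter_ok (n + m.+1)%N; have [c0 d0 e0] := nextE _ a b.
  rewrite addnS /= -[X in X / _ \in _](divfK b) -mulrA.
  by rewrite maxMl ?max_local.
have [d] := divisor_chain_bound.
(* Iterating [next] goes up the chain, so the indices are reversed. *)
move=> /(_ (fun i => iter (d - i) next l%:R)); apply.
- by move=> i _; apply: max_local; have [] := iter_ok (d - i)%N.
- by move=> i _; have [] := iter_ok (d - i)%N.
- move=> i j /andP[ij jd]; have e : (d - i = (d - j) + (j - i).-1.+1)%N by lia.
  rewrite /= e.
  exact: iter_chain.
- move=> i lt_id; have e : (d - i = 0 + (d - i).-1.+1)%N by lia.
  rewrite /= e.
  exact: (iter_chain 0%N).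
Qed.

End ValuationRing.

(** * Uniformizers and valuations *)

Section Valuation.
Variables (F : fieldType) (P : nzPrime F).
Hypothesis nfF : number_field F.
Local Notation PI := (P : prime_idealr 'O_F).
Local Notation loc := (local_ring P).
Local Notation max := (local_max_ideal P).
Implicit Types x y u : F.

(** A uniformizer, taken in the ring of integers so that its powers belong to the
    powers of the ideal [P]. *)
Definition prime_generator (b : 'O_F) : Prop :=
  [/\ b \in PI, val b != 0 & forall y, y \in max -> y / val b \in loc].

Lemma prime_generator_exists : exists b, prime_generator b.
Proof.
have [l char_l] := residue_char P.
have [x [xm x0 x_gen]] := max_principal nfF char_l.
have [b bP [u /andP[u_loc _] xE]] := max_prime_associate xm.
have : val b * u != 0 by rewrite -xE.
rewrite mulf_eq0 negb_or => /andP[b0 u0].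
exists b; split=> // y /x_gen yx.
have -> : y / val b = y / x * u by rewrite xE invfM -!mulrA mulVf // mulr1.
by rewrite rpredM.
Qed.

Variable b : 'O_F.
Hypothesis b_gen : prime_generator b.
Local Notation pi := (val b).

Let valM (c d : 'O_F) : val (c * d) = val c * val d := rmorphM _ _ _.
Let valX (c : 'O_F) n : val (c ^+ n) = val c ^+ n := rmorphXn _ _ _.
Let pi0 : pi != 0. Proof. by case: b_gen. Qed.
Let pi_max : pi \in max. Proof. by case: b_gen => bP _ _; rewrite ringInt_in_max. Qed.
Let pi_loc : pi \in loc. Proof. exact: max_local pi_max. Qed.
Let max_div y : y \in max -> y / pi \in loc. Proof. by case: b_gen => _ _; apply. Qed.

Lemma generator_uniformizer : uniformizer (@local_red F P) (int_local P b).
Proof.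
split; first exact: local_red_surj.
- move=> x; split=> [/eqP|[y ->]].
    rewrite local_red_eq0 => /max_div xb; exists (LocalInt xb).
    by apply: val_inj; rewrite rmorphM /= mulrC divfK.
  by rewrite rmorphM; apply/eqP; rewrite mulf_eq0 local_red_eq0 pi_max.
- move=> x y /(congr1 val); rewrite !rmorphM /= => /(mulfI pi0) e.
  exact: val_inj.
Qed.

(** Infinite divisibility by [pi] is a prime property, because [loc] is a
    valuation ring; so it is enough to exclude it for the residue
    characteristic, and this is the bound on chains of divisors. *)
Lemma pi_adic_separated x : x != 0 -> exists n, x / pi ^+ n \notin loc.
Proof.
have [l char_l] := residue_char P; have [char0 _] := nfF.
have l_gt1 := prime_gt1 (pcharf_prime char_l).
pose infdiv y := forall n, y / pi ^+ n \in loc.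
have infdivM y z : infdiv (y * z) -> infdiv y \/ infdiv z.
  move=> yz; apply: contrapT => /not_orP[/existsNP[n /negP yn] /existsNP[m /negP zm]].
  have := local_or_inv nfF char_l (y / pi ^+ n); rewrite (negbTE yn) /= => yV.
  have := local_or_inv nfF char_l (z / pi ^+ m); rewrite (negbTE zm) /= => zV.
  have y0 : y != 0 by apply: contraNneq yn => ->; rewrite mul0r rpred0.
  have z0 : z != 0 by apply: contraNneq zm => ->; rewrite mul0r rpred0.
  have /negP := yz (n + m)%N; apply.
  have -> : y * z / pi ^+ (n + m) = y / pi ^+ n * (z / pi ^+ m).
    by rewrite exprD mulf_div.
  apply/negP; apply: max_inv_notin; first by rewrite !mulf_neq0 // invr_neq0 // expf_neq0.
  by rewrite invfM maxMl // max_local.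
have l_fin : ~ infdiv l%:R.
  move=> l_div; have [d] := divisor_chain_bound nfF char_l.
  move=> /(_ (fun i => pi ^+ i)); apply.
  - by move=> i _; apply: rpredX.
  - by move=> i _; apply: expf_neq0.
  - move=> i j /andP[ij _]; rewrite -(subnK (ltnW ij)) exprD mulfK ?expf_neq0 //.
    by rewrite -(prednK (n := j - i)) ?subn_gt0 // exprS maxMr // rpredX.
  - move=> i _; have -> : l%:R / pi ^+ i = pi * (l%:R / pi ^+ i.+1).
      by rewrite exprS invfM mulrCA [pi * _]mulrA mulfV // mul1r.
    by rewrite maxMr.
have int_fin (c : int) : c != 0 -> ~ infdiv c%:~R.
  have [n] := ubnP `|c|%N; elim: n c => // n IHn c c_n c0.
  have [lc|lc] := boolP (l %| `|c|)%N; last first.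
    move=> /(_ 1%N); rewrite expr1 => c_pi; case/negP: lc.
    by rewrite -(int_in_max char_l) -(divfK pi0 (c%:~R)) maxMl.
  have /dvdzP[e ce] : (l %| c)%Z := lc; rewrite ce rmorphM => /infdivM[|//].
  move: c0 c_n; rewrite ce mulf_eq0 negb_or abszM => /andP[e0 _] c_n.
  apply: IHn => //; move: c_n e0; rewrite -absz_gt0 absz_nat.
  by move: l_gt1 `|e|%N; nia.
move=> x0; apply: contrapT => none; have {none} x_div : infdiv x.
  by move=> n; apply: contraT => xn; case: none; exists n.
have /local_ringP[a [s [sP xE]]] : x \in loc by have := x_div 0%N; rewrite divr1.
have a0 : a != 0.
  by apply: contraNneq x0 => a0; rewrite xE a0 rmorph0 mul0r.
have domO : no_zero_div 'O_F by move=> ? ? /eqP; rewrite mulf_eq0.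
have [c [t [c0 cE]]] := integral_multiple domO a0 (ringInt_integral a).
apply: (int_fin c); first by apply: contraNneq c0 => ->.
move=> n; have -> : c%:~R / pi ^+ n = val (t * s) * (x / pi ^+ n).
  rewrite mulrA; congr (_ / _); rewrite -(rmorph_int (val : 'O_F -> F)) cE.
  by rewrite xE !valM -mulrA [val s * _]mulrC divfK ?(notin_prime_neq0 sP).
by rewrite rpredM ?x_div ?int_local_proof.
Qed.

Definition has_order x (z : int) : Prop :=
  exists u, [/\ u \in loc, u \notin max & x = pi ^ z * u].

Lemma has_order_exists x : x != 0 -> exists z, has_order x z.
Proof.
have [l char_l] := residue_char P.
have pos y : y != 0 -> y \in loc -> exists n : nat, has_order y n.
  move=> y0 y_loc; have ex_n := pi_adic_separated y0.
  case: (ex_minnP ex_n) => -[|n] yn n_min; first by rewrite divr1 y_loc in yn.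
  exists n, (y / pi ^+ n); split.
  - by apply: contraT => /n_min; rewrite ltnn.
  - by apply: contra yn => /max_div; rewrite exprSr invfM mulrA.
  - by rewrite mulrC divfK // expf_neq0.
move=> x0; have [x_loc|x_nloc] := boolP (x \in loc).
  by have [n xn] := pos x x0 x_loc; exists n.
have := local_or_inv nfF char_l x; rewrite (negbTE x_nloc) /= => /max_local xV.
have [|n [u [u_loc u_max xE]]] := pos _ _ xV; first by rewrite invr_eq0.
exists (- n%:Z), u^-1; split; first exact: local_inv.
  have u0 : u != 0 by apply: contraNneq u_max => ->; apply: max0.
  by apply: contraL u_loc => uV; apply: max_inv_notin.
by rewrite -[x]invrK xE invfM invr_expz.
Qed.

Lemma has_orderM x y z w :
  has_order x z -> has_order y w -> has_order (x * y) (z + w).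
Proof.
move=> [u [u_loc u_max ->]] [v [v_loc v_max ->]]; exists (u * v); split.
- exact: rpredM.
- apply: contra u_max => uv; have v0 : v != 0.
    by apply: contraNneq v_max => ->; apply: max0.
  by rewrite -(mulfK v0 u) maxMr // local_inv.
- by rewrite expfzDr // mulrACA.
Qed.

Lemma has_orderV x z : has_order x z -> has_order x^-1 (- z).
Proof.
move=> [u [u_loc u_max ->]]; exists u^-1; split; first exact: local_inv.
  have u0 : u != 0 by apply: contraNneq u_max => ->; apply: max0.
  by apply: contraL u_loc => uV; apply: max_inv_notin.
by rewrite invfM invr_expz.
Qed.

Lemma has_order_pi n : has_order (pi ^+ n) n.
Proof. by exists 1; rewrite mulr1 rpred1 max1. Qed.

Lemma has_order_local x z : has_order x z -> (x \in loc) = (0 <= z).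
Proof.
move=> [u [u_loc u_max ->]]; case: z => n.
  by rewrite rpredM ?rpredX.
transitivity false; last by []; rewrite NegzE; apply/negP => xl; case/negP: u_max.
have -> : u = pi ^+ n.+1 * (pi ^ (- n.+1%:Z) * u).
  by rewrite mulrA -exprnN divff ?mul1r // expf_neq0.
by rewrite maxMr // exprS maxMr // rpredX.
Qed.

Lemma has_order_neq0 x z : has_order x z -> x != 0.
Proof.
move=> [u [_ u_max ->]]; rewrite mulf_neq0 ?expfz_neq0 //.
by apply: contraNneq u_max => ->; apply: max0.
Qed.

Lemma has_order_unique x z w : has_order x z -> has_order x w -> z = w.
Proof.
move=> xz xw; have x0 := has_order_neq0 xz.
have := has_order_local (has_orderM xz (has_orderV xw)).
have := has_order_local (has_orderM xw (has_orderV xz)).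
rewrite divff // rpred1 !subr_ge0 => /esym wz /esym zw.
by apply/eqP; rewrite eq_le wz zw.
Qed.

Lemma has_order_divX x z n : has_order x z ->
  (x / pi ^+ n \in loc) = (n%:Z <= z).
Proof.
move=> xz; have := has_orderM xz (has_orderV (has_order_pi n)).
by move=> /has_order_local ->; rewrite subr_ge0.
Qed.

Lemma idealX_add n (x y : 'O_F) :
  idealX PI n x -> idealX PI n y -> idealX PI n (x + y).
Proof.
case: n => [//|n] [r [c [d [cP dP ->]]]] [r' [c' [d' [cP' dP' ->]]]].
exists (r + r')%N, (fun i => match fintype.split i with inl j => c j | inr j => c' j end),
  (fun i => match fintype.split i with inl j => d j | inr j => d' j end); split.
- by move=> i; case: fintype.split.
- by move=> i; case: fintype.split.
rewrite big_split_ord /=; congr (_ + _); apply: eq_bigr => i _.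
  by rewrite -[lshift _ _]/(unsplit (inl i)) unsplitK.
by rewrite -[rshift _ _]/(unsplit (inr i)) unsplitK.
Qed.

Lemma idealX_mul n (x y : 'O_F) : idealX PI n x -> idealX PI n (y * x).
Proof.
case: n => [//|n] [r [c [d [cP dP ->]]]].
exists r, (fun i => y * c i), d; split=> //.
  by move=> i; apply: idealMr.
by rewrite mulr_sumr; apply: eq_bigr => i _; rewrite mulrA.
Qed.

Lemma idealX_exp n (x : 'O_F) : x \in PI -> idealX PI n (x ^+ n).
Proof.
move=> xP; elim: n => [//|n IHn]; exists 1%N, (fun=> x), (fun=> x ^+ n).
by split=> //; rewrite big_ord1 exprS.
Qed.

(** An element [x] of order at least [n] satisfies [t x = b^n c] with [t]
    outside [P]; the factor [t] is removed with the [n]-th power of an element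
    [1 - t u] of [P]. *)
Lemma idealXE n (x : 'O_F) : idealX PI n x <-> val x / pi ^+ n \in loc.
Proof.
split.
  elim: n x => [|n IHn] x; first by rewrite divr1 int_local_proof.
  case=> r [c [d [cP dP ->]]]; rewrite rmorph_sum mulr_suml rpred_sum // => i _.
  have -> : val (c i * d i) / pi ^+ n.+1 = val (c i) / pi * (val (d i) / pi ^+ n).
    by rewrite rmorphM exprS mulf_div.
  apply: rpredM; first by apply: max_div; rewrite ringInt_in_max.
  exact/IHn/dP.
case/local_ringP=> c [t [tP xE]].
have t0 : reduce P t != 0 by rewrite reduce_eq0.
have [u uE] := reduce_surj (reduce P t)^-1.
have tu : 1 - t * u \in PI.
  by rewrite -reduce_eq0 rmorphB rmorph1 rmorphM /= uE divff // subrr.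
have txE : t * x = c * b ^+ n.
  apply: val_inj; rewrite !valM valX.
  rewrite -[val x](divfK (expf_neq0 n pi0)) xE mulrA [val t * _]mulrC.
  by rewrite divfK //; apply: notin_prime_neq0 tP.
have [w wE] : exists w, (1 - t * u) ^+ n = 1 - t * w.
  elim: n {xE txE} => [|n [w wE]]; first by exists 0; rewrite mulr0 subr0.
  by exists (w + u - u * t * w); rewrite exprS wE; ring.
have -> : x = x * (1 - t * u) ^+ n + w * c * b ^+ n.
  by rewrite wE -mulrA -txE; ring.
have [bP _ _] := b_gen.
by apply: idealX_add; apply: idealX_mul; apply: idealX_exp.
Qed.

Lemma largest_interval (Q : set nat) n :
  (forall k, Q k <-> (k <= n)%N) -> largest Q = n.
Proof.
move=> QE; apply: xget_unique => [|k [Qk k_max]].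
  by split=> [|j]; [apply/QE | move/QE].
by apply/eqP; rewrite eqn_leq k_max ?(QE n) // andbT; apply/QE.
Qed.

Lemma ringInt_val_atE (x : 'O_F) n :
  has_order (val x) n%:Z -> ringInt_val_at P x = n.
Proof.
move=> xn; apply: largest_interval => k.
by rewrite /= idealXE (has_order_divX _ xn) lez_nat.
Qed.

Lemma order_ringInt (x : 'O_F) : x != 0 ->
  has_order (val x) (ringInt_val_at P x)%:Z.
Proof.
move=> x0; have [|z xz] := @has_order_exists (val x).
  by rewrite (inj_eq val_inj x 0).
have := has_order_local xz; rewrite int_local_proof.
by case: z xz => // n xn _; rewrite (ringInt_val_atE xn).
Qed.

(** Orders are additive, so all fractions representing [x] give the same
    difference. *)
Lemma valuationE x z : has_order x z -> valuation P x = z%:E.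
Proof.
move=> xz; have x0 := has_order_neq0 xz; rewrite /valuation (negbTE x0).
congr (_%:E).
have orders (c d : 'O_F) : d != 0 -> x = val c / val d ->
    z = (ringInt_val_at P c)%:Z - (ringInt_val_at P d)%:Z.
  move=> d0 xE; have c0 : c != 0.
    by apply: contraNneq x0 => c0; rewrite xE c0 rmorph0 mul0r.
  apply: (has_order_unique xz); rewrite xE.
  exact: has_orderM (order_ringInt c0) (has_orderV (order_ringInt d0)).
apply: xget_unique; last by move=> y [c [d [d0 xE ->]]]; apply/esym/orders.
have [l char_l] := residue_char P.
have frac y : y \in loc -> exists c d : 'O_F, d != 0 /\ y = val c / val d.
  case/local_ringP=> c [d [dP yE]]; exists c, d; split=> //.
  by apply: contraNneq dP => ->; apply: idealr0.
case/orP: (local_or_inv nfF char_l x) => [/frac|/max_local/frac].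
  by case=> c [d [d0 xE]]; exists c, d; split=> //; apply: orders.
case=> d [c [c0 xE]]; have d0 : d != 0.
  by apply: contraNneq x0 => d0; rewrite -[x]invrK xE d0 rmorph0 mul0r invr0.
have {}xE : x = val c / val d by rewrite -[x]invrK xE invf_div.
by exists c, d; split=> //; apply: orders.
Qed.

Lemma valuation_leE x n :
  (valuation P x <= (n%:Z)%:E)%E <-> x / pi ^+ n.+1 \notin loc.
Proof.
have [->|x0] := eqVneq x 0.
  by rewrite mul0r rpred0 /valuation eqxx; split.
have [z xz] := has_order_exists x0.
rewrite (valuationE xz) (has_order_divX _ xz) lee_fin -ltNge.
by rewrite -[n.+1]addn1 PoszD ltzD1.
Qed.

End Valuation.

(** * Maximality at a prime *)

Lemma singular_at_mull (A : comNzRingType) (k : fieldType)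
    (red : {rmorphism A -> k}) (pi : A) psi (q t : {poly A}) :
  singular_at red pi psi q -> singular_at red pi psi (t * q).
Proof.
case=> u [v [w [du dv dw ->]]]; exists (t * u), v, (t * w).
by split; rewrite // ?rmorphM ?dvdp_mull //; ring.
Qed.

Lemma poly_common_denominator (R S : comNzRingType) (iota : {rmorphism R -> S})
    (D : R -> Prop) : D 1 -> (forall s t, D s -> D t -> D (s * t)) ->
    (forall x, exists s y, D s /\ iota y = iota s * x) ->
  forall g, exists s G, D s /\ map_poly iota G = (iota s)%:P * g.
Proof.
move=> D1 DM frac; elim/poly_ind => [|g c [s [G [Ds GE]]]].
  by exists 1, 0; rewrite rmorph0 mulr0.
have [t [y [Dt yE]]] := frac c.
exists (s * t), (t%:P * G * 'X + (s * y)%:P); split; first exact: DM.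
rewrite rmorphD 2!rmorphM /= map_polyX !map_polyC GE /= !rmorphM /= yE !rmorphM.
by ring.
Qed.

Section Denominators.
Variables (F : fieldType) (P : nzPrime F).
Local Notation PI := (P : prime_idealr 'O_F).

Lemma poly_prime_denominator (g : {poly localInt P}) : exists s G,
  s \notin PI /\ map_poly (@int_local F P) G = (int_local P s)%:P * g.
Proof.
apply: (@poly_common_denominator _ _ _ (fun s : 'O_F => s \notin PI)).
- exact: notin_prime1.
- exact: notin_primeM.
move=> x; have /local_ringP[a [t [tP xE]]] := valP x.
exists t, a; split=> //; apply: val_inj.
transitivity (val t * val x); last exact/esym/(rmorphM (val : localInt P -> F)).
by rewrite xE mulrC divfK //; apply: notin_prime_neq0 tP.
Qed.

Hypothesis nfF : number_field F.
Variable b : 'O_F.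
Hypothesis b_gen : prime_generator P b.

Lemma pi_denominator (x : F) : exists n, val b ^+ n * x \in local_ring P.
Proof.
have [->|x0] := eqVneq x 0; first by exists 0%N; rewrite mulr0 rpred0.
have [z xz] := has_order_exists nfF b_gen x0.
exists `|z|%N; have := has_orderM b_gen (has_order_pi P b `|z|%N) xz.
by move/(has_order_local b_gen) ->; lia.
Qed.

Lemma poly_pi_denominator (g : {poly F}) : exists n (G : {poly localInt P}),
  map_poly val G = (val b ^+ n)%:P * g.
Proof.
have valX n : val (int_local P b ^+ n) = val b ^+ n := rmorphXn _ _ _.
have [||x|s [G [[n ->] GE]]] := @poly_common_denominator _ _ val
  (fun s => exists n, s = int_local P b ^+ n) _ _ _ g.
- by exists 0%N.
- by move=> _ _ [n ->] [m ->]; exists (n + m)%N; rewrite exprD.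
- have [n xn] := pi_denominator x; exists (int_local P b ^+ n), (LocalInt xn).
  split; first by exists n.
  exact: (congr1 (fun y => y * x) (esym (valX n))).
by exists n, G; rewrite -valX; apply: GE.
Qed.

End Denominators.

Section MaximalAt.
Variables (K : fieldExtType rat) (p : nzPrime K) (b : 'O_K).
Hypothesis b_gen : prime_generator p b.
Variables (L : fieldExtType K) (alpha : L).
Local Notation A := (localInt p).
Local Notation PI := (p : prime_idealr 'O_K).

Let valA : {rmorphism A -> K} := val.
Definition local_alg : {rmorphism A -> L} := in_alg L \o valA.
Let valO : {rmorphism 'O_K -> K} := val.
Definition int_alg : {rmorphism 'O_K -> L} := in_alg L \o valO.

Lemma local_algE x : local_alg x = (val x)%:A. Proof. by []. Qed.

Lemma ext_polyE (q : {poly 'O_K}) : ext_poly L q = map_poly int_alg q.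
Proof. by []. Qed.

Lemma ext_poly_local (q : {poly 'O_K}) :
  ext_poly L q = map_poly local_alg (map_poly (int_local p) q).
Proof. by rewrite ext_polyE -map_poly_comp. Qed.

Definition local_eval : {rmorphism {poly A} -> L} :=
  horner_eval alpha \o map_poly local_alg.

Lemma local_evalE u : local_eval u = (map_poly local_alg u).[alpha].
Proof. by []. Qed.

Lemma localize_adjoin x :
  localize p (adjoin_integers alpha) x <-> exists u, x = local_eval u.
Proof.
split=> [[n [c [y [c_loc /choice[q qE] ->]]]]|[u ->]].
  exists (\sum_i (LocalInt (c_loc i))%:P * map_poly (int_local p) (q i)).
  rewrite rmorph_sum; apply: eq_bigr => i _.
  rewrite rmorphM !local_evalE map_polyC hornerC -ext_poly_local -qE /=.
  by rewrite mulr_algl.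
exists (size u), (fun i => val u`_i), (fun i => alpha ^+ i); split.
- by move=> i; apply: valP.
- by move=> i; exists 'X^i; rewrite ext_polyE map_polyXn hornerXn.
rewrite local_evalE (horner_coef_wide _ (size_poly _ _)).
by apply: eq_bigr => i _; rewrite coef_map -mulr_algl.
Qed.

Lemma integral_integers_ext (x : L) :
  integralOver int_alg x -> x \in integers L.
Proof.
case=> q q_monic qx; apply/integersP.
apply: integral_root_monic qx _; first by rewrite monic_map.
apply/integral_poly => i; rewrite coef_map; exact/integersP/integers_ext.
Qed.

(** A common denominator [s] of the coefficients of a monic equation for [x]
    becomes the leading coefficient of an equation over the integers, so [s x]
    is an integer. *)
Lemma localize_integers x :
  localize p [set y | y \in integers L] x <-> integralOver local_alg x.
Proof.
split=> [[n [c [y [c_loc y_int ->]]]]|].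
  apply: (big_ind (fun z => integralOver local_alg z)).
  - exact: integral0.
  - by move=> ? ?; apply: integral_add.
  move=> i _; have -> : c i *: y i = local_alg (LocalInt (c_loc i)) * y i.
    by rewrite local_algE mulr_algl.
  apply: integral_mul; first exact: integral_id.
  have /integersP[q q_monic qy] := y_int i.
  exists (map_poly intr q); first by rewrite monic_map.
  rewrite -map_poly_comp; congr (root _ _): qy; apply: eq_map_poly => z /=.
  exact/esym/(rmorph_int local_alg).
case=> g g_monic gx; have [s [G [sP GE]]] := poly_prime_denominator g.
have s0 : val s != 0 := notin_prime_neq0 sP.
have int_local_inj : injective (int_local p).
  by move=> y z /(congr1 val) e; apply: val_inj.
have G_lead : lead_coef G = s.
  apply: (int_local_inj); rewrite -(lead_coef_map_inj int_local_inj) ?rmorph0 //.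
  by rewrite GE lead_coef_Mmonic // lead_coefC.
have Gx : root (map_poly int_alg G) x.
  have -> : map_poly int_alg G = map_poly local_alg (map_poly (int_local p) G).
    by rewrite -map_poly_comp.
  by rewrite GE rmorphM rootM gx orbT.
have G_size : (1 < size G)%N.
  rewrite ltnNge; apply/negP => /size1_polyC; move: G`_0 => c GC.
  move: Gx G_lead; rewrite GC map_polyC rootC lead_coefC => /eqP c0 cs.
  have : (val s)%:A == 0 :> L by rewrite -cs; apply/eqP.
  by rewrite scaler_eq0 oner_eq0 orbF (negbTE s0).
have sx : val s *: x \in integers L.
  rewrite -mulr_algl -G_lead; apply: integral_integers_ext.
  exact: integral_lead_coef G_size Gx.
exists 1%N, (fun=> (val s)^-1), (fun=> val s *: x); split=> //.
  move=> _; apply: local_inv; first exact: int_local_proof.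
  by rewrite ringInt_in_max.
by rewrite big_ord1 scalerA mulVf // scale1r.
Qed.

Variable q : {poly 'O_K}.
Hypothesis q_monic : q \is monic.
Hypothesis q_irr : irreducible_poly (map_poly val q : {poly K}).
Hypothesis q_alpha : root (ext_poly L q) alpha.
Hypothesis alpha_gen : <<1; alpha>>%VS = fullv :> {vspace L}.
Local Notation qA := (map_poly (int_local p) q).

(** The remainder in the division by the monic [q] vanishes at [alpha], so it is
    zero: its degree is less than that of the irreducible [q]. *)
Lemma local_eval_ker u : local_eval u = 0 <-> exists s, u = qA * s.
Proof.
have qA_monic : qA \is monic by rewrite monic_map.
have qA_alpha : local_eval qA = 0.
  by rewrite local_evalE -ext_poly_local; apply/rootP.
split=> [u0|[s ->]]; last by rewrite rmorphM qA_alpha mul0r.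
have uE := Pdiv.RingMonic.rdivp_eq qA_monic u.
set r := Pdiv.CommonRing.rmodp u qA in uE.
have r_size : (size r < size qA)%N.
  by rewrite Pdiv.CommonRing.ltn_rmodp monic_neq0.
exists (Pdiv.CommonRing.rdivp u qA); rewrite mulrC {1}uE.
suff -> : r = 0 by rewrite addr0.
have valA_inj : injective valA by exact: val_inj.
apply: (map_inj_poly valA_inj (rmorph0 valA)); rewrite rmorph0; apply/eqP.
apply: contraT => rK0.
have qKE : map_poly valA qA = map_poly val q by rewrite -map_poly_comp.
have cop : coprimep (map_poly val q) (map_poly valA r).
  rewrite irreducible_poly_coprime //; apply: contraL r_size => /(dvdp_leq rK0).
  by rewrite -qKE !(size_map_inj_poly valA_inj (rmorph0 valA)) leqNgt.
have qK_alpha : root (map_poly (in_alg L) (map_poly val q)) alpha.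
  by rewrite -map_poly_comp.
have := cop; rewrite -(coprimep_map (in_alg L)) => /coprimep_root/(_ qK_alpha).
case/negP; apply/eqP; rewrite -map_poly_comp.
by have := u0; rewrite uE rmorphD rmorphM qA_alpha mulr0 add0r.
Qed.

Lemma local_eval_gen x : exists n u, local_alg (int_local p b) ^+ n * x = local_eval u.
Proof.
have : x \in <<1; alpha>>%VS by rewrite alpha_gen memvf.
case/Fadjoin_polyP=> _ /polyOver1P[g ->] ->.
have [n [G GE]] := poly_pi_denominator (number_field_rat K) b_gen g.
exists n, G; rewrite local_evalE.
have -> : map_poly local_alg G = map_poly (in_alg L) (map_poly val G).
  by rewrite -map_poly_comp.
rewrite GE [map_poly _ (_ * g)]rmorphM /= map_polyC hornerM hornerC /=.
by congr (_ * _); apply/esym/(rmorphXn (in_alg L)).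
Qed.

Lemma maximal_at_regular : maximal_at p alpha <->
  forall psi, irreducible_poly psi ->
    ~ singular_at (@local_red K p) (int_local p b) psi qA.
Proof.
have unif := generator_uniformizer b_gen.
have pi0 : local_alg (int_local p b) != 0.
  by rewrite local_algE scaler_eq0 oner_eq0 orbF; case: b_gen.
have qA_monic : qA \is monic by rewrite monic_map.
split=> [max psi psi_irr sing|regular].
  have [beta beta_int []] := singular_not_closed unif pi0 qA_monic local_evalE
    local_eval_ker psi_irr sing.
  apply/localize_adjoin; rewrite -[localize _ _ _]/((localize p _) beta) max.
  exact/localize_integers.
apply/predeqP => x; split=> [/localize_adjoin[u ->]|/localize_integers x_int].
  apply/localize_integers; rewrite local_evalE; apply: integral_horner.
    by apply/integral_poly => i; rewrite coef_map; apply: integral_id.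
  exists qA => //; by rewrite -ext_poly_local.
apply/localize_adjoin.
exact: (regular_integral_closed unif pi0 qA_monic local_evalE local_eval_ker
  local_eval_gen regular).
Qed.

End MaximalAt.

(** The root and the field that it generates are arbitrary on the left, while the
    right side depends on [q] only.  The unit leading coefficient is divided out,
    which does not affect singularity. *)
Lemma maximal_poly_at_regular (K : fieldExtType rat) (p : nzPrime K) (b : 'O_K)
    (q : {poly 'O_K}) : prime_generator p b -> lead_coef q \is a GRing.unit ->
    irreducible_poly (map_poly val q : {poly K}) ->
  maximal_poly_at p q <-> forall psi, irreducible_poly psi ->
    ~ singular_at (@local_red K p) (int_local p b) psi (map_poly (int_local p) q).
Proof.
move=> b_gen q_unit q_irr; set c := lead_coef q in q_unit.
pose q1 := c^-1%:P * q; have qE : q = c%:P * q1.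
  by rewrite /q1 mulrA -rmorphM /= mulrV // mul1r.
have q1_monic : q1 \is monic.
  by rewrite monicE /q1 lead_coefM lead_coefC -/c mulVr.
have c0 : val c != 0.
  rewrite (inj_eq val_inj c 0).
  by apply: contraTneq q_unit => ->; rewrite unitr0.
have valK_E : map_poly val q = (val c)%:P * map_poly val q1 :> {poly K}.
  by rewrite {1}qE rmorphM; congr (_ * _); apply: (map_polyC (val : 'O_K -> K)).
have q1_eqp : map_poly val q1 %= (map_poly val q : {poly K}).
  by rewrite valK_E mul_polyC eqp_sym eqp_scale.
have q1_irr : irreducible_poly (map_poly val q1 : {poly K}).
  by apply: eqp_irreducible q_irr; rewrite eqp_sym.
have root_q1 (L : fieldExtType K) (alpha : L) :
    root (ext_poly L q) alpha = root (ext_poly L q1) alpha.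
  have -> : ext_poly L q = ((val c)%:A)%:P * ext_poly L q1.
    rewrite !ext_polyE {1}qE rmorphM; congr (_ * _).
    exact: (map_polyC (int_alg L)).
  by rewrite rootM rootC scaler_eq0 oner_eq0 orbF (negbTE c0).
have sing_q1 psi :
    singular_at (@local_red K p) (int_local p b) psi (map_poly (int_local p) q) <->
    singular_at (@local_red K p) (int_local p b) psi (map_poly (int_local p) q1).
  by split=> /singular_at_mull sing; [rewrite rmorphM | rewrite qE rmorphM].
split=> [[L [alpha [q_alpha alpha_gen max]]] psi psi_irr /sing_q1 sing|regular].
  rewrite root_q1 in q_alpha.
  exact: ((maximal_at_regular b_gen q1_monic q1_irr q_alpha alpha_gen).1 max psi).
have [L _ [alpha alpha_root alpha_gen]] := irredp_FAdjoin q1_irr.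
have q_alpha : root (ext_poly L q1) alpha by rewrite -map_poly_comp in alpha_root.
exists L, alpha; split=> //; first by rewrite root_q1.
apply/(maximal_at_regular b_gen q1_monic q1_irr q_alpha alpha_gen).
by move=> psi psi_irr /sing_q1; apply: regular.
Qed.

(** * Singular points and values at nearby roots *)

Lemma irreducible_root_dvd (k l : fieldType) (s : {rmorphism k -> l})
    (psi c : {poly k}) x : irreducible_poly psi -> root (map_poly s psi) x ->
  root (map_poly s c) x = (psi %| c).
Proof.
move=> irr psi_x; apply/idP/idP => [c_x|/dvdpP[d ->]]; last first.
  by rewrite rmorphM rootM psi_x orbT.
apply: contraT; rewrite -irreducible_poly_coprime // -(coprimep_map s).
by move=> /coprimep_root/(_ psi_x); rewrite -[_ == 0]/(root _ _) c_x.
Qed.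

Section Evaluation.
Variables (A A' : comNzRingType) (k k' : fieldType).
Variables (red : {rmorphism A -> k}) (red' : {rmorphism A' -> k'}).
Variables (tau : {rmorphism A -> A'}) (sigma : {rmorphism k -> k'}).
Variables (pi : A) (pi' : A').
Hypothesis unif : uniformizer red pi.
Hypothesis unif' : uniformizer red' pi'.
Hypothesis tau_pi : GRing.lreg (tau pi).
Hypothesis tau_red : forall x, red' (tau x) = sigma (red x).
Implicit Types u v w q : {poly A}.
Local Notation "u ^r" := (map_poly red u) (at level 2, format "u ^r").

Lemma red_eval u theta :
  red' (map_poly tau u).[theta] = (map_poly sigma u^r).[red' theta].
Proof.
rewrite -horner_map -!map_poly_comp; congr (_.[_]).
exact: eq_map_poly.
Qed.

(** Modulo [tau pi * pi'], the value at [theta] of [q = u v + pi w] is that of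
    [pi w]; and [w(theta)] is a unit unless [psi] divides [w] modulo [pi]. *)
Lemma singular_at_evalE psi q theta :
    irreducible_poly psi -> root (map_poly sigma psi) (red' theta) ->
    (psi %| q^r -> exists u v w, [/\ psi %| u^r, psi %| v^r,
        q = u * v + pi%:P * w &
        exists z, (map_poly tau (u * v)).[theta] = tau pi * (pi' * z)]) ->
  (exists y, (map_poly tau q).[theta] = tau pi * (pi' * y)) <->
  singular_at red pi psi q.
Proof.
move=> psi_irr psi_theta dec; have [psi_q|npsi_q] := boolP (psi %| q^r); last first.
  split=> [[y qy]|/(singular_at_sq unif)]; last first.
    move=> sq; case/negP: npsi_q; apply: dvdp_trans sq; rewrite expr2.
    exact: dvdp_mulr.
  case/negP: npsi_q; rewrite -(irreducible_root_dvd _ psi_irr psi_theta).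
  rewrite rootE -red_eval qy rmorphM tau_red.
  by rewrite (red_pi unif) rmorph0 mul0r.
have [u [v [w [psi_u psi_v -> [z uvz]]]]] := dec psi_q.
rewrite singular_atE ?irredp_neq0 //.
rewrite -(irreducible_root_dvd _ psi_irr psi_theta) rootE -red_eval.
have -> : (map_poly tau (u * v + pi%:P * w)).[theta] =
    tau pi * (pi' * z + (map_poly tau w).[theta]).
  rewrite rmorphD /= hornerD uvz (rmorphM _ pi%:P) /= map_polyC.
  by rewrite hornerM hornerC mulrDr.
case: unif' => _ ker' _; split=> [[y /tau_pi e]|/eqP/ker'[y ->]].
  by apply/eqP/ker'; exists (y - z); rewrite mulrBr -e addrC addKr.
by exists (z + y); rewrite (mulrDr pi').
Qed.

End Evaluation.

Section IntegralRoots.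
Variables (F : fieldType) (P : nzPrime F).
Hypothesis nfF : number_field F.
Local Notation loc := (local_ring P).
Local Notation max := (local_max_ideal P).
Local Notation B := (localInt P).
Let valB : {rmorphism B -> F} := val.

Let valB_inj : injective valB. Proof. exact: val_inj. Qed.

Lemma local_or_inv_max x : (x \in loc) || (x^-1 \in max).
Proof. have [l char_l] := residue_char P. exact: (local_or_inv nfF char_l x). Qed.

(** If [1 / x] were in the maximal ideal, an equation of integral dependence,
    divided by the highest power of [x], would put [1] there. *)
Lemma local_integrally_closed x : integralOver (val : B -> F) x -> x \in loc.
Proof.
case=> g g_monic gx; have [//|x_nloc] := boolP (x \in loc).
have := local_or_inv_max x; rewrite (negbTE x_nloc) /= => xV.
have x0 : x != 0 by apply: contraNneq x_nloc => ->; apply: rpred0.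
case/negP: (max1 P); pose n := (size g).-1.
have g_size : size g = n.+1.
  by rewrite /n prednK // size_poly_gt0 monic_neq0.
have -> : 1 = - \sum_(i < n) valB g`_i * x^-1 ^+ (n - i).
  apply: (mulIf (expf_neq0 n x0)); rewrite mul1r mulNr mulr_suml.
  apply/eqP; rewrite -addr_eq0 addrC; apply/eqP.
  rewrite -[RHS](rootP gx) (@horner_coef_wide _ n.+1); last first.
    by rewrite -g_size size_poly.
  rewrite big_ord_recr coef_map; congr (_ + _); last first.
    have -> : g`_n = 1 by apply/eqP; rewrite -monicE.
    by rewrite [X in X * _](rmorph1 valB) mul1r.
  apply: eq_bigr => i _; rewrite coef_map -mulrA; congr (_ * _).
  have -> : x ^+ n = x ^+ (n - i) * x ^+ i by rewrite -exprD subnK // ltnW.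
  by rewrite mulrA -exprMn mulVf // expr1n mul1r.
apply: maxN; apply: (big_ind (fun y => y \in max)); [exact: max0 | exact: maxD|].
move=> i _; rewrite maxMl ?(valP g`_i) //.
by rewrite -(prednK (n := n - i)) ?subn_gt0 // exprS maxMr // rpredX // max_local.
Qed.

(** A polynomial with a unit leading coefficient takes non-integral values at
    non-integral points: otherwise such a point would be integral. *)
Lemma eval_notin_local (q : {poly B}) (x y : F) : val (lead_coef q) != 0 ->
    (val (lead_coef q))^-1 \in loc -> (1 < size q)%N -> x \notin loc ->
  (map_poly val q).[x] \notin loc.
Proof.
move=> c0 cV q_size; apply: contra => qx.
pose q' := q - (LocalInt qx)%:P.
have q'_size : size q' = size q.
  rewrite size_polyDl // size_polyN size_polyC.
  by apply: leq_ltn_trans q_size; case: eqP.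
have q'_lead : lead_coef q' = lead_coef q.
  rewrite lead_coefDl // size_polyN size_polyC.
  by apply: leq_ltn_trans q_size; case: eqP.
have q'_x : root (map_poly valB q') x.
  have -> : map_poly valB q' = map_poly valB q - (valB (LocalInt qx))%:P.
    by rewrite rmorphB; congr (_ - _); apply: (map_polyC valB).
  by rewrite rootE hornerD hornerN hornerC; apply/eqP; apply: subrr.
rewrite -q'_size in q_size.
have := local_integrally_closed (integral_lead_coef q_size q'_x).
rewrite q'_lead => cx; rewrite -(mulKf c0 x).
by apply: rpredM.
Qed.

Lemma local_poly_lift (g : {poly F}) : (forall i, g`_i \in loc) ->
  exists G : {poly B}, map_poly val G = g.
Proof.
move=> g_loc; exists (\poly_(i < size g) LocalInt (g_loc i)).
apply/polyP => i; rewrite coef_map coef_poly.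
by case: ltnP => // gi; rewrite nth_default // (rmorph0 valB).
Qed.

(** If [u] splits over [F] then its reduction splits over the residue field,
    with the reductions of the [P]-integral roots of [u] as its roots: a
    non-integral root [t] contributes the factor [1 - X / t] up to a constant,
    and this factor reduces to [1]. *)
Lemma splits_root_lift (u : {poly B}) (chi : {poly residue P}) :
    splits (map_poly val u) -> map_poly (@local_red F P) u != 0 ->
    (1 < size chi)%N -> chi %| map_poly (@local_red F P) u ->
  exists2 t : B, root u t & root chi (local_red t).
Proof.
case=> c [rs]; elim: rs u c => [|t rs IHrs] u c uE u0 chi_size chi_u.
  move: uE; rewrite big_nil alg_polyC => uE.
  have /size1_polyC uc : (size u <= 1)%N.
    rewrite -(size_map_inj_poly valB_inj (rmorph0 _)) [map_poly _ _]uE.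
    by rewrite size_polyC; case: eqP.
  have := dvdp_leq u0 chi_u; rewrite uc map_polyC /= size_polyC.
  by move: chi_size; case: (size chi) => [|[|m]] //; case: (_ != 0).
move: uE; rewrite big_cons scalerAr => uE.
have [t_loc|t_nloc] := boolP (t \in loc).
  pose t' := LocalInt t_loc.
  have ut : root u t'.
    rewrite rootE -(inj_eq valB_inj) rmorph0 -horner_map.
    by rewrite [map_poly _ _]uE hornerM hornerXsubC subrr mul0r.
  have [u1 u1E] := factor_theorem _ _ ut.
  have redE : map_poly (@local_red F P) u =
      map_poly (@local_red F P) u1 * ('X - (local_red t')%:P).
    by rewrite u1E rmorphM /= map_polyXsubC.
  have [chi_t|nchi_t] := boolP (root chi (local_red t')); first by exists t'.
  have u10 : map_poly (@local_red F P) u1 != 0.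
    by apply: contraNneq u0 => u10; rewrite redE u10 mul0r.
  have [||s u1s chi_s] := IHrs u1 c _ u10 chi_size.
  - apply: (mulIf (negbT (polyXsubC_eq0 t))).
    rewrite [RHS]mulrC -uE u1E rmorphM; congr (_ * _).
    exact/esym/(map_polyXsubC valB).
  - move: chi_u; rewrite redE Gauss_dvdpl //.
    by rewrite coprimep_XsubC.
  by exists s => //; rewrite u1E rootE hornerM (rootP u1s) mul0r.
have := local_or_inv_max t; rewrite (negbTE t_nloc) /= => tV.
have t0 : t != 0 by apply: contraNneq t_nloc => ->; apply: rpred0.
have tV_loc := max_local tV.
have [g gdef] : exists g, g = - t *: (c *: \prod_(j <- rs) ('X - j%:P)).
  by exists (- t *: (c *: \prod_(j <- rs) ('X - j%:P))).
have gE : map_poly valB u = (1 - t^-1 *: 'X) * g.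
  have XtE : 'X - t%:P = - t *: (1 - t^-1 *: 'X).
    rewrite scalerBr scalerA mulNr mulfV // scaleN1r opprK alg_polyC polyCN.
    by rewrite addrC.
  by rewrite [map_poly _ _]uE XtE gdef -scalerAl; apply: scalerAr.
have g_loc i : g`_i \in loc.
  have g_coef j : g`_j = valB u`_j + t^-1 * (if j == 0%N then 0 else g`_j.-1).
    rewrite -coef_map gE mulrBl mul1r coefB -scalerAl coefZ coefXM.
    by rewrite subrK.
  elim: i => [|i IHi]; rewrite g_coef ?mulr0 ?addr0 ?rpredD ?rpredM //.
  - exact: (valP u`_0).
  - exact: (valP u`_i.+1).
have [G GE] := local_poly_lift g_loc.
pose s := LocalInt tV_loc.
have uGE : u = (1 - s *: 'X) * G.
  apply: (map_inj_poly valB_inj (rmorph0 valB)).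
  rewrite gE [RHS]rmorphM; congr (_ * _); last exact/esym/GE.
  rewrite [RHS]rmorphB rmorph1 -!mul_polyC [X in _ = _ - X]rmorphM.
  by congr (_ - _ * _); apply/esym; [apply: (map_polyC valB) | apply: map_polyX].
have redE : map_poly (@local_red F P) u = map_poly (@local_red F P) G.
  rewrite uGE rmorphM rmorphB rmorph1 -mul_polyC rmorphM /= map_polyC /=.
  have -> : local_red s = 0 by apply/eqP; rewrite local_red_eq0.
  by rewrite mul0r subr0 mul1r.
have [|||r Gr chi_r] := IHrs G (- t * c) _ _ chi_size.
- by rewrite [map_poly _ _]GE gdef scalerA.
- by rewrite -redE.
- by rewrite -redE.
by exists r => //; rewrite uGE rootE hornerM (rootP Gr) mulr0.
Qed.

End IntegralRoots.

(** * Primes above a prime *)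

Section Above.
Variables (K : fieldExtType rat) (M : fieldExtType K).
Variables (p : nzPrime K) (P : nzPrime M).
Local Notation PK := (p : prime_idealr 'O_K).
Local Notation PM := (P : prime_idealr 'O_M).
Let nfM : number_field M := number_field_ext M.

Lemma val_ringInt_ext x : val (ringInt_ext M x) = (val x)%:A.
Proof. by []. Qed.

Lemma ringInt_extB : {morph ringInt_ext M : x y / x - y}.
Proof.
move=> x y; apply: val_inj; rewrite [RHS](rmorphB (val : 'O_M -> M)).
rewrite !val_ringInt_ext -scalerBl; congr (_ *: _).
Qed.

Lemma ringInt_extM : {morph ringInt_ext M : x y / x * y}.
Proof.
move=> x y; apply: val_inj; rewrite [RHS](rmorphM (val : 'O_M -> M)).
rewrite !val_ringInt_ext -(rmorphM (in_alg M)); congr (_ *: _).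
Qed.

Lemma ringInt_ext1 : ringInt_ext M 1 = 1.
Proof.
apply: val_inj; rewrite [RHS](rmorph1 (val : 'O_M -> M)) val_ringInt_ext.
by rewrite [val 1](rmorph1 (val : 'O_K -> K)) scale1r.
Qed.

(** The hypothesis makes the map independent of the representative; as an
    argument of the definition it lets the structure of ring morphism be
    attached to the map. *)
Definition residue_ext of lies_above p P := fun y : residue p =>
  reduce P (ringInt_ext M (repr y)).

Hypothesis above : lies_above p P.

Lemma local_ext_proof (x : localInt p) : (val x)%:A \in local_ring P.
Proof.
have /local_ringP[a [s [sP ->]]] := valP x; apply/local_ringP.
exists (ringInt_ext M a), (ringInt_ext M s); split; first by rewrite above.
by rewrite !val_ringInt_ext; apply: (fmorph_div (in_alg M)).
Qed.

Definition local_ext (x : localInt p) : localInt P := LocalInt (local_ext_proof x).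

Fact local_ext_zmod : zmod_morphism local_ext.
Proof.
move=> x y; apply: val_inj; rewrite [RHS](rmorphB (val : localInt P -> M)) /=.
by rewrite -scalerBl.
Qed.
Fact local_ext_monoid : monoid_morphism local_ext.
Proof.
split=> [|x y]; apply: val_inj; first by rewrite /= scale1r.
rewrite [RHS](rmorphM (val : localInt P -> M)) /=.
by rewrite -(rmorphM (in_alg M)).
Qed.
HB.instance Definition _ :=
  GRing.isZmodMorphism.Build (localInt p) (localInt P) local_ext local_ext_zmod.
HB.instance Definition _ :=
  GRing.isMonoidMorphism.Build (localInt p) (localInt P) local_ext local_ext_monoid.

Local Notation sigma := (residue_ext above).

Lemma residue_extE x : sigma (reduce p x) = reduce P (ringInt_ext M x).
Proof.
rewrite /residue_ext; apply/eqP; rewrite -subr_eq0 -rmorphB -ringInt_extB.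
have e : reduce p (repr (reduce p x)) = reduce p x by rewrite /reduce reprK.
by rewrite reduce_eq0 above -reduce_eq0 rmorphB subr_eq0; apply/eqP/e.
Qed.

Fact residue_ext_zmod : zmod_morphism sigma.
Proof.
move=> x y; have [c <-] := reduce_surj x; have [d <-] := reduce_surj y.
by rewrite -rmorphB !residue_extE ringInt_extB rmorphB.
Qed.
Fact residue_ext_monoid : monoid_morphism sigma.
Proof.
split=> [|x y].
  by rewrite -(rmorph1 (reduce p)) residue_extE ringInt_ext1 rmorph1.
have [c <-] := reduce_surj x; have [d <-] := reduce_surj y.
by rewrite -rmorphM !residue_extE ringInt_extM rmorphM.
Qed.
HB.instance Definition _ :=
  GRing.isZmodMorphism.Build (residue p) (residue P) sigma residue_ext_zmod.
HB.instance Definition _ :=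
  GRing.isMonoidMorphism.Build (residue p) (residue P) sigma residue_ext_monoid.

Lemma local_red_ext x : local_red (local_ext x) = sigma (local_red x).
Proof.
have /local_ringP[a [s [sP xE]]] := valP x.
have sigma_div y z : sigma (y / z) = sigma y / sigma z := fmorph_div _ _ _.
rewrite (local_redE sP xE) sigma_div !residue_extE; apply: local_redE.
  by rewrite above.
rewrite !val_ringInt_ext [LHS]/= -[localInt_val x]/(val x) xE.
exact: (fmorph_div (in_alg M)).
Qed.

Variables (b : 'O_K) (c : 'O_M).
Hypothesis b_gen : prime_generator p b.
Hypothesis c_gen : prime_generator P c.

Let b0 : (val b)%:A != 0 :> M.
Proof. by rewrite scaler_eq0 oner_eq0 orbF; case: b_gen. Qed.

(** Locally at [p] the ideal is generated by [b], so its exponent at [P] is the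
    order of [b]. *)
Lemma ramification_order :
  has_order P c (val b)%:A (ramification_index p P)%:Z.
Proof.
have [[n|n] bn] := has_order_exists nfM c_gen b0; last first.
  by have := has_order_local c_gen bn; rewrite (int_local_proof P (ringInt_ext M b)).
suff -> : ramification_index p P = n by [].
apply: largest_interval => k /=; split=> [sub|kn x xp].
  have [bp _ _] := b_gen.
  have /(idealXE c_gen) := sub b bp.
  by rewrite val_ringInt_ext (has_order_divX c_gen _ bn).
have [_ b1 b_div] := b_gen.
have xb : val x / val b \in local_ring p by rewrite b_div // ringInt_in_max.
apply/(idealXE c_gen); rewrite val_ringInt_ext.
have -> : (val x)%:A / val c ^+ k = (val x / val b)%:A * ((val b)%:A / val c ^+ k).
  by rewrite mulrA -(rmorphM (in_alg M)) divfK.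
rewrite rpredM ?(local_ext_proof (LocalInt xb)) //.
by rewrite (has_order_divX c_gen _ bn).
Qed.

(** As [e] is the order of [b] and [c] has order [1], a valuation greater than
    [e] means divisibility by [b c]. *)
Lemma valuation_le_ramificationE (x : M) :
  (valuation P x <= ((ramification_index p P)%:Z)%:E)%E <->
  x / ((val b)%:A * val c) \notin local_ring P.
Proof.
rewrite (valuation_leE nfM c_gen).
have [->|x0] := eqVneq x 0; first by rewrite !mul0r.
have [z xz] := has_order_exists nfM c_gen x0.
have bc := has_orderM c_gen ramification_order (has_order_pi P c 1).
rewrite expr1 in bc.
rewrite (has_order_divX c_gen _ xz).
rewrite (has_order_local c_gen (has_orderM c_gen xz (has_orderV bc))).
by rewrite subr_ge0 -PoszD addn1.
Qed.

Lemma valuation_local_leE (x : localInt P) :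
  (valuation P (val x) <= ((ramification_index p P)%:Z)%:E)%E <->
  ~ exists y, x = local_ext (int_local p b) * (int_local P c * y).
Proof.
have c0 : val c != 0 by case: c_gen.
rewrite valuation_le_ramificationE; split=> [/negP nx [y xE]|nx].
  apply: nx; have -> : val x = (val b)%:A * val c * val y.
    rewrite xE [LHS](rmorphM (val : localInt P -> M)).
    by rewrite [X in _ * X](rmorphM (val : localInt P -> M)) mulrA.
  by rewrite mulrC mulKf ?mulf_neq0 // (valP y).
apply/negP => xl; apply: nx; exists (LocalInt xl); apply: val_inj.
rewrite [RHS](rmorphM (val : localInt P -> M)).
rewrite [X in _ * X](rmorphM (val : localInt P -> M)) mulrA /=.
by rewrite mulrC divfK // mulf_neq0.
Qed.

End Above.

(** * The residue field, and auxiliary factorizations *)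

Section ResiduePerfect.
Variables (F : fieldType) (P : nzPrime F) (l : nat).
Hypothesis char_l : l \in [pchar (residue P)].

(** The residue field is algebraic over its prime field, so the iterated
    Frobenius images of [y] lie in a finite set; a coincidence between two of
    them shows that [y] is its own image under an iterate of Frobenius. *)
Lemma residue_perfect (y : residue P) : exists x, y = x ^+ l.
Proof.
have l_gt0 := prime_gt0 (pcharf_prime char_l).
have [z zy] := reduce_surj y; have [q q_monic qz] := ringInt_integral z.
have qy : (map_poly intr q).[y] = 0.
  have e : reduce P \o (intr : int -> 'O_F) =1 (intr : int -> residue P).
    by move=> n; exact: (rmorph_int (reduce P)).
  by rewrite -zy -(eq_map_poly e) map_poly_comp horner_map (rootP qz) rmorph0.
pose n := size q; pose r j := Pdiv.CommonRing.rmodp 'X^(l ^ j) q.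
have rE j : y ^+ (l ^ j) = \sum_(i < n) ((r j)`_i)%:~R * y ^+ i.
  have r_size : (size (r j) <= n)%N.
    by rewrite ltnW // Pdiv.CommonRing.ltn_rmodp monic_neq0.
  have := congr1 (fun g => (map_poly (intr : int -> residue P) g).[y])
    (Pdiv.RingMonic.rdivp_eq q_monic 'X^(l ^ j)).
  rewrite map_polyXn hornerXn rmorphD rmorphM hornerD hornerM /= qy mulr0 add0r.
  move=> ->; rewrite (horner_coef_wide y (leq_trans (size_poly _ _) r_size)).
  by apply: eq_bigr => i _; rewrite coef_map.
pose code j : {ffun 'I_n -> 'I_l.-1.+1} :=
  [ffun i : 'I_n => inord `|((r j)`_i %% l)%Z|%N].
have codeE j (i : 'I_n) : ((code j i : nat)%:R = ((r j)`_i)%:~R :> residue P).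
  rewrite ffunE inordK; last first.
    rewrite prednK // -ltz_nat gez0_abs ?modz_ge0 ?ltz_pmod //.
    by rewrite -lt0n.
  have lR : (l%:Z)%:~R = 0 :> residue P := pcharf0 char_l.
  rewrite [in RHS](divz_eq (r j)`_i l) rmorphD rmorphM /= lR.
  by rewrite mulr0 add0r -[in RHS](gez0_abs (modz_ge0 _ _)) // -lt0n.
have [i [j [ij eij]]] : exists i j, (i < j)%N /\ code i = code j.
  apply: contrapT => none.
  have inj : injective (fun j : 'I_(#|{ffun 'I_n -> 'I_l.-1.+1}|).+1 => code j).
    move=> i j eij; apply: val_inj; apply/eqP; apply: contraT.
    by rewrite neq_ltn => /orP[ij|ji]; case: none; [exists i, j | exists j, i].
  by have := leq_card _ inj; rewrite card_ord ltnn.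
have yij : y ^+ (l ^ i) = y ^+ (l ^ j).
  by rewrite !rE; apply: eq_bigr => h _; rewrite -!codeE eij.
pose m := (j - i).-1; have jE : j = (m.+1 + i)%N by rewrite /m; lia.
exists (y ^+ (l ^ m)); rewrite -exprM -expnSr.
have frobX h (x : residue P) : iter h (pFrobenius_aut char_l) x = x ^+ (l ^ h).
  elim: h => [|h IHh]; first by rewrite expn0 expr1.
  by rewrite iterS IHh pFrobenius_autE -exprM -expnSr.
have frob_inj : injective (iter i (pFrobenius_aut char_l)).
  elim: (i) => [|h IHh] u v //= /fmorph_inj; exact: IHh.
by apply: frob_inj; rewrite !frobX yij jE -exprM -expnD.
Qed.

End ResiduePerfect.

Lemma irreducible_factors_seq (k : fieldType) (c : {poly k}) : c != 0 ->
  exists s : seq {poly k},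
    (forall phi, phi \in s -> irreducible_poly phi /\ phi %| c) /\
    (forall psi, irreducible_poly psi -> psi %| c ->
       exists2 phi, phi \in s & psi %= phi).
Proof.
have [n] := ubnP (size c); elim: n c => // n IHn c c_n c0.
have [c_size|c_size] := leqP (size c) 1.
  exists [::]; split=> // psi psi_irr /(dvdp_leq c0).
  by move=> /leq_trans/(_ c_size); rewrite leqNgt psi_irr.1.
have [phi phi_irr /dvdpP[d cE]] := irreducible_factor c_size.
have d0 : d != 0 by apply: contraNneq c0 => d0; rewrite cE d0 mul0r.
have [|//|s [s_irr s_all]] := IHn d.
  move: c_n; rewrite cE size_mul ?(irredp_neq0 phi_irr) //.
  by have := phi_irr.1; move: (size phi) (size d); lia.
exists (phi :: s); split=> [psi|psi psi_irr].
  rewrite inE => /predU1P[->|/s_irr[]]; first by rewrite cE dvdp_mull.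
  by rewrite cE => ? ?; split=> //; apply: dvdp_mulr.
rewrite cE irreducible_dvdM // => /orP[/(s_all _ psi_irr)[chi chi_s psi_chi]|].
  by exists chi => //; rewrite inE chi_s orbT.
move=> psi_phi; exists phi; first by rewrite inE eqxx.
apply: phi_irr.2 psi_phi; apply/eqP => psi1.
by have := psi_irr.1; rewrite psi1.
Qed.

(** Since [psi] divides [c o h], it divides [phi o h] for an irreducible factor
    [phi] of [c]; it divides [G o h] as well, so [phi] divides [G]. *)
Lemma singular_pullback (A : comNzRingType) (k : fieldType)
    (red : {rmorphism A -> k}) (pi : A) (psi c : {poly k}) (G h : {poly A}) :
    uniformizer red pi -> irreducible_poly psi -> c != 0 ->
    psi %| c \Po map_poly red h ->
    (forall phi, irreducible_poly phi -> phi %| c -> phi %| map_poly red G ->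
       phi ^+ 2 %| map_poly red G) ->
    singular_at red pi psi (G \Po h) ->
  exists phi, [/\ irreducible_poly phi, phi %| c & singular_at red pi phi G].
Proof.
move=> unif psi_irr c0 psi_c sq sing.
have [phi [phi_irr phi_c psi_phi]] := irreducible_factor_comp psi_irr c0 psi_c.
exists phi; split=> //.
apply: (singular_at_comp unif phi_irr psi_irr _ psi_phi sing); apply: sq => //.
apply: (irreducible_dvd_comp phi_irr psi_irr psi_phi).
rewrite -map_comp_poly; apply: dvdp_trans (singular_at_sq unif sing).
by rewrite expr2 dvdp_mulr.
Qed.

(** The degree of [phi ^+ n] is at least [n], so every exponent [n] such that
    [phi ^+ n] divides [q] is within the bound [size q] of the definition. *)
Lemma multiplicity_dvd (k : fieldType) (phi q : {poly k}) (n : nat) :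
    irreducible_poly phi -> q != 0 ->
  (phi ^+ n %| q) = (n <= multiplicity phi q)%N.
Proof.
move=> phi_irr q0; have q_size : (0 < size q)%N by rewrite size_poly_gt0.
have small m : phi ^+ m %| q -> (m < size q)%N.
  move=> /(dvdp_leq q0); apply: leq_trans; have := size_exp phi m.
  have : (0 < size (phi ^+ m))%N.
    by rewrite size_poly_gt0 expf_neq0 // irredp_neq0.
  by have := phi_irr.1; move: (size phi) (size (phi ^+ m)) => x y; nia.
apply/idP/idP => [phi_q|].
  exact: (leq_bigmax_cond (Ordinal (small _ phi_q))).
move=> n_le; suff : phi ^+ multiplicity phi q %| q.
  by apply: dvdp_trans; apply: dvdp_exp2l.
have [|i i_dvd iE] := @eq_bigmax_cond _ (fun m : 'I_(size q) => phi ^+ m %| q) val.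
  by apply/card_gt0P; exists (Ordinal q_size); rewrite unfold_in /= expr0 dvd1p.
by have -> : multiplicity phi q = val i := iE.
Qed.

Section Primitive.
Variables (F : fieldType) (P : nzPrime F).
Hypothesis nfF : number_field F.

(** Divide by [pi] until some coefficient becomes a unit. *)
Lemma primitive_scaling (G : {poly localInt P}) : G != 0 ->
  exists x (G' : {poly localInt P}),
    [/\ x != 0, map_poly val G = x *: (map_poly val G' : {poly F})
      & map_poly (@local_red F P) G' != 0].
Proof.
have [b b_gen] := prime_generator_exists P nfF.
have unif := generator_uniformizer b_gen; have [_ b0 _] := b_gen.
move=> G0; pose i := (size G).-1.
have Gi : val G`_i != 0.
  rewrite (inj_eq val_inj _ 0) -lead_coefE lead_coef_eq0.
  exact: G0.
have [n] := pi_adic_separated nfF b_gen Gi.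
elim: n G {G0} i Gi => [|n IHn] G i Gi; first by rewrite divr1 (valP G`_i).
move=> Gin; have [|G0] := eqVneq (map_poly (@local_red F P) G) 0; last first.
  by exists 1, G; rewrite oner_neq0 scale1r.
move=> /(red_poly_ker unif)[G' GE].
have GiE : val G`_i = val b * val G'`_i.
  by rewrite GE coefCM; apply: (rmorphM (val : localInt P -> F)).
have G'i : val G'`_i != 0.
  by apply: contraNneq Gi => G'i; rewrite GiE G'i mulr0.
have [|x [H [x0 G'E H0]]] := IHn G' i G'i.
  by apply: contra Gin; rewrite GiE exprS invfM mulrACA divff // mul1r.
exists (val b * x), H; split=> //; first by rewrite mulf_neq0.
rewrite -scalerA -G'E GE -mul_polyC [LHS]rmorphM; congr (_ * _).
exact: (map_polyC (val : localInt P -> F)).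
Qed.

End Primitive.

Lemma comp_poly_exp (R : comNzRingType) (u h : {poly R}) n :
  (u ^+ n) \Po h = (u \Po h) ^+ n.
Proof.
by elim: n => [|n IHn]; rewrite ?expr0 ?comp_polyC // !exprS comp_polyM IHn.
Qed.

(** * Iteration *)

Section Iteration.
Variable R : comNzRingType.
Implicit Types f q : {poly R}.

Lemma fiterS f n : fiter f n.+1 = f \Po fiter f n.
Proof. by []. Qed.

Lemma fiter1 f : fiter f 1 = f.
Proof. by rewrite fiterS comp_polyXr. Qed.

Lemma fiterD f m n : fiter f (m + n) = fiter f m \Po fiter f n.
Proof.
elim: m => [|m IHm]; first by rewrite comp_polyX.
by rewrite addSn !fiterS IHm comp_polyA.
Qed.

Lemma fiterD_sub f (a : R) m n :
  fiter f (m + n) - a%:P = (fiter f m - a%:P) \Po fiter f n.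
Proof. by rewrite fiterD comp_polyB comp_polyC. Qed.

Lemma deriv_fiterS f n :
  (fiter f n.+1)^`() = ((fiter f n)^`() \Po f) * f^`().
Proof. by rewrite -addn1 fiterD fiter1 deriv_comp. Qed.

End Iteration.

Lemma map_fiter (R S : comNzRingType) (s : {rmorphism R -> S}) f n :
  map_poly s (fiter f n) = fiter (map_poly s f) n.
Proof.
elim: n => [|n IHn]; first exact: map_polyX.
by rewrite !fiterS map_comp_poly IHn.
Qed.

Lemma fiter_size_lead (R : idomainType) (f : {poly R}) n : (1 < size f)%N ->
    lead_coef f \is a GRing.unit ->
  (1 < size (fiter f n))%N /\ lead_coef (fiter f n) \is a GRing.unit.
Proof.
move=> f_size f_unit; elim: n => [|n [IH1 IH2]].
  by rewrite size_polyX lead_coefX unitr1.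
rewrite fiterS lead_coef_comp // unitrM f_unit unitrX //; split=> //.
have := size_comp_poly f (fiter f n); move: f_size IH1.
by move: (size f) (size (fiter f n)) (size (f \Po fiter f n)) => x y z; nia.
Qed.

(** By the chain rule a critical point of an iterate is mapped to a critical
    point of [f] along its orbit. *)
Lemma irreducible_dvd_deriv_fiter (k : fieldType) (f psi : {poly k}) n :
    irreducible_poly psi -> psi %| (fiter f n)^`() ->
  exists2 j, (j < n)%N & psi %| f^`() \Po fiter f j.
Proof.
move=> psi_irr; elim: n => [|n IHn].
  rewrite derivX => /dvdp_leq; rewrite oner_neq0 size_poly1 => /(_ isT).
  by rewrite leqNgt psi_irr.1.
rewrite fiterS deriv_comp irreducible_dvdM // => /orP[|/IHn[j jn psi_j]].
  by exists n.
by exists j => //; apply: ltnW.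
Qed.

(** * The criterion *)

Section Criterion.
Variables (K : fieldExtType rat) (N : nat) (f : {poly 'O_K}) (a : 'O_K).
Hypothesis f_size : (1 < size f)%N.
Hypothesis f_unit : lead_coef f \is a GRing.unit.
Hypothesis irr : forall n, (1 <= n <= N)%N ->
  irreducible_poly (map_poly val (fiter f n - a%:P) : {poly K}).
Variables (p : nzPrime K) (b : 'O_K).
Hypothesis b_gen : prime_generator p b.

Local Notation red := (@local_red K p).
Local Notation pi := (int_local p b).
Local Notation k := (residue p).
Local Notation F n := (map_poly (int_local p) (fiter f n - a%:P)).
Local Notation "u ^r" := (map_poly red u) (at level 2, format "u ^r").
Local Notation "u ^l" := (map_poly (int_local p) u) (at level 2, format "u ^l").

Let unif : uniformizer red pi := generator_uniformizer b_gen.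

Lemma red_local_poly u : (u^l)^r = reduce_poly p u.
Proof.
rewrite -map_poly_comp; apply: eq_map_poly => x /=; exact: local_red_int.
Qed.

Lemma F_size_lead n : (0 < n)%N ->
  (1 < size (fiter f n - a%:P)%R)%N /\ lead_coef (fiter f n - a%:P) \is a GRing.unit.
Proof.
move=> n0; have [s l] := fiter_size_lead n f_size f_unit.
have a_small : (size (- a%:P)%R < size (fiter f n))%N.
  by rewrite size_polyN size_polyC; apply: leq_ltn_trans s; case: eqP.
by rewrite size_polyDl // lead_coefDl.
Qed.

Lemma F_add m n : F (m + n) = F m \Po (fiter f n)^l.
Proof. by rewrite fiterD_sub map_comp_poly. Qed.

Lemma ext_poly_local_ext (M : fieldExtType K) (P : nzPrime M)
    (above : lies_above p P) (u : {poly 'O_K}) :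
  ext_poly M u = map_poly val (map_poly (local_ext above) u^l).
Proof. by rewrite -!map_poly_comp. Qed.

Lemma ext_poly_eval (M : fieldExtType K) (P : nzPrime M)
    (above : lies_above p P) (u : {poly 'O_K}) (theta : localInt P) :
  (ext_poly M u).[val theta] = val (map_poly (local_ext above) u^l).[theta].
Proof.
by rewrite (ext_poly_local_ext above) (horner_map (val : localInt P -> M)).
Qed.

Lemma root_ext_poly (M : fieldExtType K) (P : nzPrime M)
    (above : lies_above p P) (u : {poly 'O_K}) (theta : localInt P) :
  root (ext_poly M u) (val theta) = root (map_poly (local_ext above) u^l) theta.
Proof. by rewrite !rootE (ext_poly_eval above) -(inj_eq val_inj _ 0). Qed.

(** The value at [theta] is not in the local ring of [P], let alone divisible by
    [b c]. *)
Lemma valuation_le_nonintegral (M : fieldExtType K) (P : nzPrime M)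
    (above : lies_above p P) (q : {poly 'O_K}) (theta : M) :
    (1 < size q)%N -> lead_coef q \is a GRing.unit -> theta \notin local_ring P ->
  (valuation P (ext_poly M q).[theta] <=
     ((ramification_index p P)%:Z)%:E)%E.
Proof.
move=> q_size q_unit theta_nloc; have nfM := number_field_ext M.
have [c c_gen] := prime_generator_exists P nfM.
apply/(valuation_le_ramificationE above b_gen c_gen).
pose Q := map_poly (local_ext above) q^l.
have [x xl] : exists x, x * lead_coef q = 1.
  by exists (lead_coef q)^-1; apply: mulVr.
have ext_x : val (local_ext above (int_local p x)) *
    val (local_ext above (int_local p (lead_coef q))) = 1.
  rewrite -(rmorphM (val : localInt P -> M)) -!rmorphM xl !rmorph1.
  exact: (rmorph1 (val : localInt P -> M)).
have ext_inj : injective (local_ext above \o int_local p).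
  move=> y z /(congr1 val) /= /(fmorph_inj (in_alg M)); exact: val_inj.
have QE : Q = map_poly (local_ext above \o int_local p) q.
  by rewrite map_poly_comp.
have Q_lead : lead_coef Q = local_ext above (int_local p (lead_coef q)).
  by rewrite QE lead_coef_map_inj // rmorph0.
have Qx : (map_poly val Q).[theta] \notin local_ring P.
  apply: eval_notin_local => //.
  - rewrite Q_lead; apply: contra_eq_neq ext_x => ->.
    by rewrite mulr0 eq_sym oner_eq0.
  - rewrite Q_lead.
    have -> : (val (local_ext above (int_local p (lead_coef q))))^-1 =
        val (local_ext above (int_local p x)).
      apply/eqP; rewrite -[_^-1]mul1r -ext_x mulfK //.
      by apply: contra_eq_neq ext_x => ->; rewrite mulr0 eq_sym oner_eq0.
    exact: valP.
  - by rewrite QE size_map_inj_poly // rmorph0.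
rewrite -(ext_poly_local_ext above) in Qx.
have bc_loc : (val b)%:A * val c \in local_ring P.
  by rewrite rpredM ?int_local_proof ?(local_ext_proof above (int_local p b)).
apply: contra Qx => Qbc; rewrite -[_.[_]](@divfK _ ((val b)%:A * val c)).
  by rewrite rpredM.
rewrite mulf_neq0 // ?scaler_eq0 ?oner_eq0 ?orbF; last by case: c_gen.
by case: b_gen.
Qed.

(** The common shape of the three cases.  The primes dividing [g] modulo [p]
    must detect all singular points of all the [F n]; and where such a prime
    [psi] divides [F n] modulo [p], the decomposition [F n = u v + pi w] that
    decides singularity must have [(u v)(theta)] of valuation greater than [e]
    at the roots [theta] of [g]. *)
Lemma criterion_of_decompositions (g : {poly 'O_K}) (Np : nat) :
    reduce_poly p g != 0 ->
    (forall m, (1 <= m <= Np)%N -> (1 <= m <= N)%N) ->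
    (forall n psi, (1 <= n <= N)%N -> irreducible_poly psi ->
       singular_at red pi psi (F n) ->
       exists m phi, [/\ (1 <= m <= Np)%N, irreducible_poly phi,
         phi %| reduce_poly p g & singular_at red pi phi (F m)]) ->
    (forall (M : fieldExtType K) (P : nzPrime M) (above : lies_above p P)
       (c : 'O_M) (theta : localInt P) (psi : {poly k}) (n : nat),
       prime_generator P c -> root (map_poly (local_ext above) g^l) theta ->
       irreducible_poly psi ->
       root (map_poly (residue_ext above) psi) (local_red theta) ->
       (1 <= n <= Np)%N -> psi %| (F n)^r ->
       exists u v w, [/\ psi %| u^r, psi %| v^r, F n = u * v + pi%:P * w &
         exists z, (map_poly (local_ext above) (u * v)).[theta] =
           local_ext above pi * (int_local P c * z)]) ->
  maximality_criterion f a N p g Np.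
Proof.
move=> g0 Np_N detect decompose M P g_splits above.
have nfM := number_field_ext M.
have [c c_gen] := prime_generator_exists P nfM.
have unif' := generator_uniformizer c_gen.
have pi_reg : GRing.lreg (local_ext above pi).
  move=> x y /(congr1 val).
  rewrite !(rmorphM (val : localInt P -> M)) => /mulfI e; apply/val_inj/e.
  by rewrite /= scaler_eq0 oner_eq0 orbF; case: b_gen.
have good theta psi n : root (map_poly (local_ext above) g^l) theta ->
    irreducible_poly psi ->
    root (map_poly (residue_ext above) psi) (local_red theta) ->
    (1 <= n <= Np)%N ->
    (valuation P (ext_poly M (fiter f n - a%:P)).[val theta] <=
       ((ramification_index p P)%:Z)%:E)%E <-> ~ singular_at red pi psi (F n).
  move=> g_theta psi_irr psi_theta n_Np.
  rewrite (ext_poly_eval above) (valuation_local_leE above b_gen c_gen).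
  have := singular_at_evalE unif unif' pi_reg (local_red_ext above) psi_irr
    psi_theta (decompose _ _ above c theta psi n c_gen g_theta psi_irr psi_theta n_Np).
  by move=> [s1 s2]; split=> ns s; apply: ns; [apply: s2 | apply: s1].
have maxE : (forall n, (1 <= n <= N)%N -> maximal_poly_at p (fiter f n - a%:P))
    <-> (forall n psi, (1 <= n <= N)%N -> irreducible_poly psi ->
      ~ singular_at red pi psi (F n)).
  split=> [max n psi n_N|reg n n_N].
    move: psi; apply/(maximal_poly_at_regular b_gen _ (irr n_N)); last exact: max.
    by apply: (F_size_lead _).2; case/andP: n_N.
  apply/(maximal_poly_at_regular b_gen _ (irr n_N)).
    by apply: (F_size_lead _).2; case/andP: n_N.
  by move=> psi; apply: reg.
rewrite maxE; split=> [reg theta g_theta n n_Np|val_le n psi n_N psi_irr sing].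
  have [theta_loc|theta_nloc] := boolP (theta \in local_ring P); last first.
    have [q_size q_unit] : (1 < size (fiter f n - a%:P)%R)%N /\
        lead_coef (fiter f n - a%:P) \is a GRing.unit.
      by apply: F_size_lead; case/andP: n_Np.
    exact: valuation_le_nonintegral.
  pose theta' := LocalInt theta_loc.
  have g_theta' : root (map_poly (local_ext above) g^l) theta'.
    by rewrite -root_ext_poly.
  have root_g : root (map_poly (residue_ext above) (reduce_poly p g)) (local_red theta').
    rewrite -red_local_poly rootE -(red_eval (local_red_ext above)).
    by rewrite (rootP g_theta') rmorph0.
  have [psi [psi_irr _ psi_theta]] := irreducible_factor_root g0 root_g.
  by apply/(good theta' psi) => //; apply: reg => //; apply: Np_N.
have [m [phi [m_Np phi_irr phi_g phi_sing]]] := detect n psi n_N psi_irr sing.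
pose Q := map_poly (local_ext above) g^l.
have redQ : map_poly (@local_red M P) Q =
    map_poly (residue_ext above) (reduce_poly p g).
  rewrite -red_local_poly -!map_poly_comp; apply: eq_map_poly => x /=.
  exact: local_red_ext.
have [|||//|theta Q_theta phi_theta] :=
    @splits_root_lift M P nfM Q (map_poly (residue_ext above) phi).
- by rewrite -(ext_poly_local_ext above).
- by rewrite redQ map_poly_eq0.
- by rewrite size_map_poly phi_irr.1.
- by rewrite redQ dvdp_map.
apply: (good theta phi m Q_theta phi_irr phi_theta m_Np).1 phi_sing.
apply: val_le => //.
by rewrite (root_ext_poly above).
Qed.


Local Notation fr := (reduce_poly p f).

Lemma red_F n : (F n)^r = fiter fr n - (reduce p a)%:P.
Proof.
by rewrite red_local_poly /reduce_poly rmorphB /= map_polyC map_fiter.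
Qed.

Lemma deriv_red_poly (u : {poly 'O_K}) : (reduce_poly p u)^`() = reduce_poly p u^`().
Proof. exact: deriv_map. Qed.

(** A repeated prime factor [psi] of [F n] divides the derivative of the [n]-th
    iterate, so [f^j] maps it to a critical point for some [j < n], and
    [F n = F (n - j) o f^j].  Over the perfect residue field a common zero of
    [F (n - j)] and of its derivative is a multiple zero. *)
Lemma detect_critical n psi : reduce_poly p f^`() != 0 -> (1 <= n <= N)%N ->
    irreducible_poly psi -> singular_at red pi psi (F n) ->
  exists m phi, [/\ (1 <= m <= N)%N, irreducible_poly phi,
    phi %| reduce_poly p f^`() & singular_at red pi phi (F m)].
Proof.
move=> df0 /andP[n0 nN] psi_irr sing; have [l char_l] := residue_char p.
have := dvd_sq_deriv (singular_at_sq unif sing).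
rewrite red_F derivB derivC subr0 => /(irreducible_dvd_deriv_fiter psi_irr)[j jn].
rewrite deriv_red_poly => psi_j.
have nE : n = ((n - j) + j)%N by rewrite subnK // ltnW.
rewrite nE F_add in sing.
have [||phi [phi_irr phi_df phi_sing]] := singular_pullback unif psi_irr df0 _ _ sing.
- by rewrite red_local_poly /reduce_poly map_fiter.
- move=> phi phi_irr phi_df phi_F.
  apply: (irreducible_dvd_sq char_l (residue_perfect char_l)) => //.
  rewrite red_F derivB derivC subr0 -(prednK (n := n - j)) ?subn_gt0 //.
  by rewrite deriv_fiterS deriv_red_poly dvdp_mull.
exists (n - j)%N, phi; split=> //.
by rewrite subn_gt0 jn (leq_trans (leq_subr _ _) nN).
Qed.

(** If [psi] vanishes at the reduction of a root [theta] of a lift [phi], then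
    [psi] is associated to the reduction of [phi].  So [phi^2] divides [F n]
    modulo [pi] as soon as [psi] divides [F n], while [phi(theta) = 0]. *)
Lemma criterion_lifts (s : seq {poly 'O_K}) : reduce_poly p f^`() != 0 ->
    (forall phi, phi \in s -> irreducible_poly (reduce_poly p phi) /\
       reduce_poly p phi %| reduce_poly p f^`()) ->
    (forall psi, irreducible_poly psi -> psi %| reduce_poly p f^`() ->
       exists2 phi, phi \in s & psi %= reduce_poly p phi) ->
  maximality_criterion f a N p (\prod_(phi <- s) phi) N.
Proof.
move=> df0 s_irr s_all; have [l char_l] := residue_char p.
have sE : reduce_poly p (\prod_(phi <- s) phi) = \prod_(phi <- s) reduce_poly p phi.
  exact: (rmorph_prod (map_poly (reduce p))).
apply: criterion_of_decompositions => //.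
- rewrite sE prodf_seq_neq0; apply/allP => phi /s_irr[phi_irr _] /=.
  exact: irredp_neq0.
- move=> n psi n_N psi_irr sing.
  have [m [phi [m_N phi_irr phi_df phi_sing]]] := detect_critical df0 n_N psi_irr sing.
  exists m, phi; split=> //; have [chi chi_s phi_chi] := s_all phi phi_irr phi_df.
  by rewrite (eqp_dvdl _ phi_chi) sE (big_rem chi) //= dvdp_mulr.
move=> M P above c theta psi n c_gen theta_root psi_irr psi_theta n_N psi_F.
have [phi phi_s phi_theta] : exists2 phi, phi \in s &
    root (map_poly (local_ext above) phi^l) theta.
  move: theta_root; rewrite -root_ext_poly.
  elim: (s) => [|phi t IHt]; first by rewrite big_nil ext_polyE rmorph1 (negbTE (root1 _)).
  rewrite big_cons ext_polyE rmorphM rootM => /orP[phi_theta|].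
    by exists phi; rewrite ?inE ?eqxx // -root_ext_poly.
  by move=> /IHt[chi chi_t chi_theta]; exists chi; rewrite // inE chi_t orbT.
have [phi_irr phi_df] := s_irr phi phi_s.
have psi_phi : psi %| reduce_poly p phi.
  rewrite -(irreducible_root_dvd _ psi_irr psi_theta) -red_local_poly.
  apply/rootP; rewrite -(red_eval (local_red_ext above)) (rootP phi_theta).
  exact: rmorph0.
have phi_psi : reduce_poly p phi %= psi.
  rewrite eqp_sym; apply: phi_irr.2 => //; apply/eqP => psi1.
  by have := psi_irr.1; rewrite psi1.
have : reduce_poly p phi ^+ 2 %| (F n)^r.
  apply: (irreducible_dvd_sq char_l (residue_perfect char_l)) => //.
    by rewrite (eqp_dvdl _ phi_psi).
  case/andP: n_N => n0 _; rewrite red_F derivB derivC subr0 -(prednK n0).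
  by rewrite deriv_fiterS deriv_red_poly dvdp_mull.
rewrite -red_local_poly -rmorphXn => /(red_poly_dvd unif)[y [w FE]].
exists phi^l, (phi^l * y), w; split.
- by rewrite red_local_poly.
- by rewrite rmorphM /= dvdp_mulr // red_local_poly.
- by rewrite mulrA -expr2.
exists 0; rewrite mulr0 mulr0 rmorphM hornerM.
by rewrite [X in X * _](rootP phi_theta) mul0r.
Qed.

(** At a root [theta] of an irreducible factor [h] of the derivative, primitive
    at [p], write [h = psi^m d + pi t] with [psi] prime to [d]: since
    [h(theta) = 0], the uniformizer [pi] divides [psi(theta)^m], so
    [psi(theta)^(m+1)] has valuation greater than [e].  Non-exceptionality says
    that [psi^(m+1)] divides [F n] modulo [p]. *)
Lemma criterion_non_exceptional : non_exceptional p f a ->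
  maximality_criterion f a N p f^`() N.
Proof.
move=> [df0 mult_lt]; apply: criterion_of_decompositions => //.
  by move=> n psi n_N; apply: detect_critical.
move=> M P above c theta psi n c_gen theta_root psi_irr psi_theta n_N psi_F.
have n0 : (0 < n)%N by case/andP: n_N.
have unif' := generator_uniformizer c_gen.
have df_theta : root (map_poly (in_alg M) (map_poly val f^`())) (val theta).
  have -> : map_poly (in_alg M) (map_poly val f^`()) =
      map_poly val (map_poly (local_ext above) (f^`())^l).
    by rewrite -!map_poly_comp.
  apply/rootP; rewrite (horner_map (val : localInt P -> M)) (rootP theta_root).
  exact: (rmorph0 (val : localInt P -> M)).
have df0K : map_poly val f^`() != 0 :> {poly K}.
  apply: contraNneq df0 => df0K; suff -> : f^`() = 0 by rewrite /reduce_poly map_poly0.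
  apply/eqP; rewrite -size_poly_eq0.
  rewrite -(size_map_inj_poly val_inj (rmorph0 (val : 'O_K -> K))).
  by rewrite [map_poly _ _]df0K size_poly0.
have [h [h_irr h_df h_theta]] := irreducible_factor_root df0K df_theta.
have [i [H HE]] := poly_pi_denominator (number_field_rat K) b_gen h.
have [_ b0 _] := b_gen.
have H0 : H != 0.
  apply: contraTneq (irredp_neq0 h_irr) => H0; move: HE; rewrite H0 => /esym/eqP.
  rewrite [X in _ == X](rmorph0 (map_poly (val : localInt p -> K))).
  by rewrite mulf_eq0 polyC_eq0 (negbTE (expf_neq0 i b0)) /= => ->.
have [x [G [x0 HG G0]]] := primitive_scaling (number_field_rat K) H0.
have hG : h %= map_poly val G.
  apply: (@eqp_trans _ (map_poly val H)); last by rewrite HG; apply: eqp_scale.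
  by rewrite HE mul_polyC eqp_sym; apply: eqp_scale; apply: expf_neq0.
have G_red : map_poly (local_reduce p) (map_poly val G : {poly K}) = G^r.
  have red0 : local_reduce p (0 : K) = 0 := rmorph0 red.
  by apply/polyP => j; rewrite [RHS]coef_map coef_map_id0 // coef_map.
have G_theta : (map_poly (local_ext above) G).[theta] = 0.
  apply: val_inj; rewrite -[LHS](horner_map (val : localInt P -> M)).
  rewrite [RHS](rmorph0 (val : localInt P -> M)).
  have -> : map_poly val (map_poly (local_ext above) G) =
      map_poly (in_alg M) (map_poly val G) by rewrite -!map_poly_comp.
  have e : map_poly (in_alg M) h %= map_poly (in_alg M) (map_poly val G).
    by rewrite eqp_map.
  apply/rootP; move: h_theta; rewrite !root_factor_theorem.
  by rewrite (eqp_dvdr _ e).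
have psi_G : psi %| G^r.
  rewrite -(irreducible_root_dvd _ psi_irr psi_theta); apply/rootP.
  rewrite -(red_eval (local_red_ext above)) G_theta; exact: rmorph0.
set m := multiplicity psi G^r.
have m0 : (0 < m)%N by rewrite -multiplicity_dvd.
have m_F : (m < multiplicity psi (F n)^r)%N.
  rewrite red_local_poly /m -G_red; apply: mult_lt => //.
  - exact: eqp_irreducible hG h_irr.
  - by rewrite -(eqp_dvdl _ hG).
  - by move=> j; rewrite coef_map; apply: valP.
  - have /existsNP[j Gj] : ~ forall j, G^r`_j = 0.
      by move=> Gr0; case/eqP: G0; apply/polyP => j; rewrite coef0.
    exists j; rewrite coef_map -local_red_eq0; apply/eqP => Gj0; apply: Gj.
    by rewrite coef_map.
  - by rewrite G_red.
  - by rewrite -red_local_poly.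
have F0 : (F n)^r != 0.
  by apply: contraTneq m_F => ->; rewrite /multiplicity size_poly0 big_ord0.
have [d dE] := red_poly_lift unif psi.
have : (d ^+ m)^r %| G^r by rewrite rmorphXn /= dE multiplicity_dvd.
case/(red_poly_dvd unif)=> y [t GE].
have : (d ^+ m.+1)^r %| (F n)^r by rewrite rmorphXn /= dE multiplicity_dvd.
case/(red_poly_dvd unif)=> y' [w FE].
have y_psi : ~~ (psi %| y^r).
  apply/negP => psi_y; have : (m.+1 <= m)%N; last by rewrite ltnn.
  rewrite -multiplicity_dvd // GE (red_poly_mod unif) rmorphM rmorphXn /= dE.
  by rewrite exprSr dvdp_mul.
pose ev u := (map_poly (local_ext above) u).[theta].
have evM u v : ev (u * v) = ev u * ev v by rewrite /ev rmorphM hornerM.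
have evX u j : ev (u ^+ j) = ev u ^+ j.
  by elim: j => [|j IHj]; rewrite ?exprS ?evM ?IHj // /ev rmorph1 hornerC.
have [y1 yy1] : exists y1, ev y * y1 = 1.
  apply: localInt_inv; rewrite (red_eval (local_red_ext above)).
  by rewrite -[_ == 0]/(root _ _) (irreducible_root_dvd _ psi_irr psi_theta).
have [d1 d1E] : exists d1, ev d = int_local P c * d1.
  case: unif' => _ ker _; apply/ker; rewrite (red_eval (local_red_ext above)) dE.
  exact/rootP.
have evG : ev d ^+ m * ev y + local_ext above pi * ev t = 0.
  rewrite -[RHS]G_theta GE -evX -evM /ev rmorphD hornerD; congr (_ + _).
  by rewrite rmorphM hornerM /= map_polyC hornerC.
have dm : ev d ^+ m = local_ext above pi * (- (ev t * y1)).
  rewrite -[LHS]mulr1 -yy1 mulrA; move/eqP: evG; rewrite addr_eq0 => /eqP ->.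
  by ring.
exists d, (d ^+ m * y'), w; split.
- by rewrite dE.
- by rewrite rmorphM rmorphXn /= dE -(prednK m0) exprS -mulrA dvdp_mulr.
- by rewrite mulrA -exprS.
exists (d1 * (- (ev t * y1)) * ev y').
rewrite -[LHS]/(ev _) !evM evX dm d1E; ring.
Qed.

(** Here [F 1] is the [l]-th power of [g] modulo [pi], and [F n] is [F 1] after
    an iterate, so every singular point of [F n] lies over a zero of [g] that
    is a singular point of [F 1]. *)
Lemma criterion_inseparable l (g : {poly 'O_K}) : (0 < N)%N ->
    l \in [pchar k] -> reduce_poly p (f - a%:P) = reduce_poly p g ^+ l ->
  maximality_criterion f a N p g 1.
Proof.
move=> N0 char_l fg; have l_gt1 := prime_gt1 (pcharf_prime char_l).
have F1E : (F 1)^r = (g^l)^r ^+ l by rewrite !red_local_poly fiter1.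
have F1_0 : (F 1)^r != 0.
  have [s lc] := F_size_lead (isT : (0 < 1)%N); rewrite red_local_poly.
  rewrite -lead_coef_eq0 /reduce_poly lead_coef_map_eq.
    by apply: contraTneq (rmorph_unit (reduce p) lc) => ->; rewrite unitr0.
  by apply: contraTneq (rmorph_unit (reduce p) lc) => ->; rewrite unitr0.
have g0 : reduce_poly p g != 0.
  apply: contraNneq F1_0 => g0.
  by rewrite F1E red_local_poly g0 expr0n -leqn0 leqNgt ltnW.
apply: criterion_of_decompositions => //.
- by move=> [|[|m]] //; rewrite N0.
- move=> n psi /andP[n0 _] psi_irr sing.
  have nE : n = (1 + n.-1)%N by rewrite add1n prednK.
  rewrite nE F_add in sing.
  have psi_g : psi %| reduce_poly p g \Po ((fiter f n.-1)^l)^r.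
    apply: (@irreducible_dvdX _ _ _ l) => //.
    have <- : (g^l)^r ^+ l \Po ((fiter f n.-1)^l)^r =
        (reduce_poly p g \Po ((fiter f n.-1)^l)^r) ^+ l.
      by rewrite comp_poly_exp (red_local_poly g).
    rewrite -F1E -map_comp_poly; apply: dvdp_trans (singular_at_sq unif sing).
    by rewrite expr2 dvdp_mulr.
  have [|phi [phi_irr phi_g phi_sing]] := singular_pullback unif psi_irr g0 psi_g _ sing.
    move=> phi phi_irr phi_g _; rewrite F1E red_local_poly.
    by rewrite (dvdp_trans _ (dvdp_exp2l _ l_gt1)) // dvdp_exp2r.
  by exists 1%N, phi.
move=> M P above c theta psi n c_gen theta_root psi_irr psi_theta n1 psi_F.
have {n1} nE : n = 1%N by case: n n1 {psi_F} => [|[|]].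
rewrite nE in psi_F *.
have psi_g : psi %| (g^l)^r by apply: (@irreducible_dvdX _ _ _ l); rewrite -?F1E.
have [|w FE] := @red_poly_eq _ _ _ _ unif (F 1) (g^l ^+ l).
  by rewrite F1E rmorphXn.
exists g^l, (g^l ^+ l.-1), w; split=> //.
- by rewrite rmorphXn /= -(prednK (n := l.-1)) ?exprS ?dvdp_mulr // -subn1 subn_gt0.
- by rewrite -exprS prednK // ltnW.
exists 0; rewrite mulr0 mulr0 rmorphM hornerM.
by rewrite [X in X * _](rootP theta_root) mul0r.
Qed.

End Criterion.

Theorem theorem1p1 (K : fieldExtType rat) (N : nat) (hN : (0 < N)%N)
    (f : {poly 'O_K}) (f_unit : lead_coef f \is a GRing.unit) (a : 'O_K)
    (irr : forall n : nat, (1 <= n <= N)%N ->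
       irreducible_poly (map_poly val (fiter f n - a%:P) : {poly K}))
    (p : nzPrime K) :
  [/\ exists (g : {poly 'O_K}) (Np : nat),
        (0 < Np)%N /\ maximality_criterion f a N p g Np,
      non_exceptional p f a -> maximality_criterion f a N p f^`() N,
      ~ non_exceptional p f a -> reduce_poly p f^`() != 0 ->
        forall (r : nat) (phi : 'I_r -> {poly 'O_K}),
          factor_lifts p f^`() phi ->
          maximality_criterion f a N p (\prod_(i < r) phi i) N
    & reduce_poly p f^`() = 0 ->
        forall (ell : nat) (g : {poly 'O_K}),
          ell \in [pchar (residue p)] ->
          reduce_poly p (f - a%:P) = reduce_poly p g ^+ ell ->
          maximality_criterion f a N p g 1].
Proof.
have f_size : (1 < size f)%N.
  rewrite ltnNge; apply/negP => /size1_polyC; move: f`_0 => x fE.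
  have [+ _] := irr 1%N hN; rewrite fiter1 fE.
  rewrite ltnNge -rmorphB (leq_trans (size_poly _ _)) // size_polyC.
  by case: (_ != 0).
have [b b_gen] := prime_generator_exists p (number_field_rat K).
have lift (c : {poly residue p}) : exists C, reduce_poly p C = c.
  have [s sE] := choice (@reduce_surj K p).
  exists (\poly_(i < size c) s c`_i); apply/polyP => i.
  rewrite coef_map coef_poly; case: ltnP => [_|ci]; first exact: sE.
  by rewrite raddf0 nth_default.
split.
- have [df0|df0] := eqVneq (reduce_poly p f^`()) 0.
    have [l char_l] := residue_char p.
    have [|g0 g0E] := deriv0_expr char_l (residue_perfect char_l)
        (c := reduce_poly p (f - a%:P)).
      by rewrite deriv_red_poly derivB derivC subr0.
    have [g gE] := lift g0; exists g, 1%N; split=> //.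
    by apply: (criterion_inseparable f_size f_unit irr b_gen hN char_l); rewrite gE.
  have [s [s_irr s_all]] := irreducible_factors_seq df0.
  have [L LE] := choice lift.
  exists (\prod_(phi <- map L s) phi), N; split=> //.
  apply: (criterion_lifts f_size f_unit irr b_gen df0) => [_ /mapP[phi phi_s ->]|psi].
    by rewrite LE; apply: s_irr.
  move=> psi_irr /(s_all psi psi_irr)[phi phi_s psi_phi].
  by exists (L phi); [apply: map_f | rewrite LE].
- exact: (criterion_non_exceptional f_size f_unit irr b_gen).
- move=> _ df0 r phi [phi_irr _ phi_all].
  rewrite -(big_map phi predT id).
  apply: (criterion_lifts f_size f_unit irr b_gen df0) => [_ /mapP[i _ ->] //|psi].
  move=> psi_irr /(phi_all psi psi_irr)[i psi_i].
  by exists (phi i) => //; apply: map_f; rewrite mem_index_enum.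
- by move=> _ l g; apply: (criterion_inseparable f_size f_unit irr b_gen hN).
Qed.
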